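(* Let $\mathcal S$ be a spinor module of $\mathrm{Cl}(\Gamma,\sigma,g)$ with a hermitean metric $\langle\cdot,\cdot\rangle$, and let $D$ be the Dirac operator on $\mathcal S$. Then $D$ is symmetric with respect to $\langle\cdot,\cdot\rangle$, i.e. $\langle D\varphi,\psi\rangle=\langle\varphi,D\psi\rangle$ for all $\varphi,\psi\in\mathcal S$, if and only if the following two conditions hold: (a) $\langle D\varphi,\psi\rangle=\langle\varphi,D\psi\rangle$ for all left-invariant $\varphi,\psi\in\mathcal S_L$; (b) $\langle u\varphi,\psi\rangle=\langle\varphi,\beta(u)\psi\rangle$ for all $u\in\mathrm{Cl}(\Gamma,\sigma,g)$ and $\varphi,\psi\in\mathcal S$.
   Context: $\mathcal A$ is a cosemisimple Hopf $*$-algebra over $\mathbb C$, with $\varDelta(a)=a_{(1)}\otimes a_{(2)}$, counit $\varepsilon$, antipode $S$, Haar functional $h$ ($h(1)=1$). There is an automorphism $\rho$ of $\mathcal A$ with $h(ab)=h(b\rho(a))$; $\beta(a):=\rho(a)^*$ is an algebra involution of $\mathcal A$. On the Hopf dual $\mathcal A^\circ$, $f^*(a)=\overline{f(S(a)^* )}$. Repeated indices are summed. **Calculus.** $(\Gamma,d)$ is a finite dimensional left-covariant first order differential $*$-calculus over $\mathcal A$; $\Gamma_L$ (left-invariant elements) has basis $\theta_1,\dots,\theta_n$, the quantum tangent space $\mathcal X\subset\mathcal A^\circ$ has the dual basis $X_i$: $da=a_{(1)}X_i(a_{(2)})\theta_i$. $S^2$-invariance: $S^2(\mathcal X)=\mathcal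 X$. If $S^2(X_i)=F^i_jX_j$, put $S^2(\theta_i)=F^j_i\theta_j$, $S^2(a\rho)=S^2(a)S^2(\rho)$. Let $S^2(X_i)^*=B^i_jX_j$; then $\beta(\theta_i):=\overline{B^j_i}\theta_j$ together with $\beta$ on $\mathcal A$ defines an involution $\beta$ of the bimodule $\Gamma$. Put $\omega(a)=S(a_{(1)})da_{(2)}$, $\mathcal R_\Gamma=\{b:\omega(b)=0,\varepsilon(b)=0\}$. **Braiding.** $\sigma$ is an automorphism of the left-covariant bimodule $\Gamma\otimes_{\mathcal A}\Gamma$ satisfying the braid relation, with $\omega(a_{(1)})\otimes\omega(a_{(2)})\in\ker(\mathrm{id}-\sigma)$ for $a\in\mathcal R_\Gamma$, commuting with $S^2$, and with $(\sigma\rho_2)^*=\sigma(\rho_2^* )$ for all $\rho_2$ or $(\sigma\rho_2)^*=\sigma^{-1}(\rho_2^* )$ for all $\rho_2$. **$\sigma$-metric.** $g:\Gamma\otimes_{\mathcal A}\Gamma\to\mathcal A$ is a non-degenerate homomorphism of left-covariant bimodules with $g\sigma=g$, $g_{12}\sigma^{\pm1}_{23}\sigma^{\pm1}_{12}=g_{23}$ (both signs), $g(\rho\otimes\rho')^*=g(\rho'^*\otimes\rho^* )$, and $g(S^2(\rho')\otimes\rho)=g(\rho\otimes\rho')$ for $\rho,\rho'\in\Gamma_L$. **Clifford algebra.** $\mathrm{Cl}(\Gamma,\sigma,g)=\Gamma^{\otimes}/\mathcal I$, $\Gamma^\otimes=\bigoplus_k\Gamma^{\otimes_{\mathcal A}k}$,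 $\mathcal I$ the two-sided ideal generated by $\rho_2-g(\rho_2)$ with $\sigma(\rho_2)=\rho_2$; it is a left-covariant algebra. $\beta$ extends uniquely to an involution (antilinear anti-automorphism with $\beta^2=\mathrm{id}$) of $\mathrm{Cl}(\Gamma,\sigma,g)$. **Spinor modules and metrics.** A spinor module is a left-covariant left ideal $\mathcal S$ of $\mathrm{Cl}(\Gamma,\sigma,g)$ which is also an $\mathcal A$-bimodule; $\mathcal S_L$ denotes its left-invariant elements. A metric on $\mathcal S$ is a non-degenerate hermitean form $\langle\cdot,\cdot\rangle:\mathcal S\times\mathcal S\to\mathbb C$ (antilinear in the second argument, not necessarily positive definite) such that $\langle\cdot,\cdot\rangle=h\circ\langle\cdot,\cdot\rangle_0$ for a left-covariant map $\langle\cdot,\cdot\rangle_0:\mathcal S\times\mathcal S\to\mathcal A$ with $\langle a\varphi,b\psi\rangle_0=a\langle\varphi,\psi\rangle_0b^*$ for $a,b\in\mathcal A$, $\varphi,\psi\in\mathcal S$ (left-covariance is equivalent to $\langle\varphi,\psi\rangle_0\in\mathbb C$ for $\varphi,\psi\in\mathcal S_L$). **Connections and Dirac operator.** A left connection on a bimodule $\mathcal C$ is a linear map $\nabla:\mathcal C\to\Gamma\otimes_{\mathcal A}\mathcal C$ with $\nabla(a\rho)=da\otimes\rho+a\nabla(\rho)$ for $a\in\mathcal A$, $\rho\in\mathcal C$; on a bimodule algebra it is called a linear left connection if there is a bimodule map $\tilde\sigma:\mathcal C\otimes_{\mathcal A}\Gamma\to\Gamma\otimes_{\mathcal A}\mathcal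 C$ with $\tilde\sigma(\rho\otimes da)=\nabla(\rho a)-\nabla(\rho)a$ and $\nabla(\rho\rho')=(\mathrm{id}\otimes\cdot)(\nabla(\rho)\otimes\rho'+(\tilde\sigma\otimes\mathrm{id})(\rho\otimes\nabla(\rho')))$. Let $\nabla$ be a linear left connection on $\mathrm{Cl}(\Gamma,\sigma,g)$ and let $\nabla':\mathcal S\to\Gamma\otimes_{\mathcal A}\mathcal S$ be a linear left connection on $\mathcal S$ compatible with it, i.e. $\nabla'(u\varphi)=(\mathrm{id}\otimes\cdot)(\nabla(u)\otimes\varphi+(\tilde\sigma\otimes\mathrm{id})(u\otimes\nabla'(\varphi)))$ for $u\in\mathrm{Cl}(\Gamma,\sigma,g)$, $\varphi\in\mathcal S$. The Dirac operator on $\mathcal S$ is $D:=\mathrm m\circ\nabla'$, where $\mathrm m:\Gamma\otimes_{\mathcal A}\mathcal S\to\mathcal S$ is Clifford multiplication (the left action of $\Gamma$ on $\mathcal S$).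
   Formalization: The connection ∇' on the spinor module is additionally assumed left-covariant; without this the ''if'' direction fails (e.g. on C[z,1/z], the flat connection plus zθ⊗(·) satisfies (a) and (b) but D is not symmetric). *)

(* Defs.v *)
From HB Require Import structures.
From mathcomp Require Import all_boot all_order all_algebra generic_quotient.
From mathcomp Require Import boolp.

Set Implicit Arguments.
Unset Strict Implicit.
Unset Printing Implicit Defensive.

Import GRing.Theory Num.Theory.
Local Open Scope ring_scope.
Local Open Scope quotient_scope.

(* The C-module generated by X and presented by the class [adm] of admissible *)
(* maps: two formal linear combinations are identified when no admissible map *)
(* into any C-module separates them.                                          *)
Section PresentedModule.
Variables (C : numClosedFieldType) (X : Type).
Variable adm : forall V : lmodType C, (X -> V) -> Prop.

Definition pmod_eval (V : lmodType C) (f : X -> V) (s : seq (C * {classic X})) : V :=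
  \sum_(p <- s) p.1 *: f p.2.

Definition pmod_rel (s t : seq (C * {classic X})) : bool :=
  `[< forall (V : lmodType C) (f : X -> V),
        adm f -> pmod_eval f s = pmod_eval f t >].

Lemma pmod_rel_equiv : equiv_class_of pmod_rel.
Proof.
split=> [s|s t|t s u].
- by apply/asboolP.
- by apply/asboolP/asboolP => H V f /H.
- by move=> /asboolP H1 /asboolP H2; apply/asboolP => V f Hf; rewrite H1 ?H2.
Qed.

Canonical pmod_equiv := EquivRelPack pmod_rel_equiv.

Definition pmod := {eq_quot pmod_equiv}.
HB.instance Definition _ := Choice.on pmod.

Definition pmod_lift (V : lmodType C) (f : X -> V) (t : pmod) : V :=
  pmod_eval f (repr t).

Definition pmod_of (s : seq (C * {classic X})) : pmod := \pi_pmod s.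
Definition pmod_gen (x : X) : pmod := pmod_of [:: (1, x : {classic X})].

Lemma pmod_lift_of (V : lmodType C) (f : X -> V) s :
  adm f -> pmod_lift f (pmod_of s) = pmod_eval f s.
Proof.
move=> Hf; rewrite /pmod_lift /pmod_of.
by have /eqquotP/asboolP := reprK (\pi_pmod s); apply.
Qed.

Lemma pmod_ext (t u : pmod) :
  (forall (V : lmodType C) (f : X -> V), adm f -> pmod_lift f t = pmod_lift f u) ->
  t = u.
Proof.
by move=> H; rewrite -[t]reprK -[u]reprK; apply/eqquotP/asboolP.
Qed.

Definition pmod_zero : pmod := pmod_of [::].
Definition pmod_add (t u : pmod) : pmod := pmod_of (repr t ++ repr u).
Definition pmod_scale (c : C) (t : pmod) : pmod :=
  pmod_of [seq (c * p.1, p.2) | p <- repr t].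
Definition pmod_opp (t : pmod) : pmod := pmod_scale (-1) t.

Lemma lift_zero (V : lmodType C) (f : X -> V) : adm f -> pmod_lift f pmod_zero = 0.
Proof. by move=> Hf; rewrite pmod_lift_of // /pmod_eval big_nil. Qed.

Lemma lift_add (V : lmodType C) (f : X -> V) t u : adm f ->
  pmod_lift f (pmod_add t u) = pmod_lift f t + pmod_lift f u.
Proof. by move=> Hf; rewrite pmod_lift_of // /pmod_eval big_cat. Qed.

Lemma lift_scale (V : lmodType C) (f : X -> V) c t : adm f ->
  pmod_lift f (pmod_scale c t) = c *: pmod_lift f t.
Proof.
move=> Hf; rewrite pmod_lift_of // /pmod_lift /pmod_eval big_map scaler_sumr.
by apply: eq_bigr => p _; rewrite scalerA.
Qed.

Lemma pmod_addA : associative pmod_add.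
Proof. by move=> t u v; apply: pmod_ext => V f Hf; rewrite !lift_add // addrA. Qed.
Lemma pmod_addC : commutative pmod_add.
Proof. by move=> t u; apply: pmod_ext => V f Hf; rewrite !lift_add // addrC. Qed.
Lemma pmod_add0 : left_id pmod_zero pmod_add.
Proof. by move=> t; apply: pmod_ext => V f Hf; rewrite !lift_add // lift_zero // add0r. Qed.
Lemma pmod_addN : left_inverse pmod_zero pmod_opp pmod_add.
Proof.
move=> t; apply: pmod_ext => V f Hf.
by rewrite lift_add // lift_zero // lift_scale // scaleN1r addNr.
Qed.

HB.instance Definition _ := GRing.isZmodule.Build pmod pmod_addA pmod_addC pmod_add0 pmod_addN.

Lemma pmod_scaleA (a b : C) (t : pmod) :
  pmod_scale a (pmod_scale b t) = pmod_scale (a * b) t.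
Proof. by apply: pmod_ext => V f Hf; rewrite !lift_scale // scalerA. Qed.
Lemma pmod_scale1 : left_id 1 pmod_scale.
Proof. by move=> t; apply: pmod_ext => V f Hf; rewrite !lift_scale // scale1r. Qed.
Lemma pmod_scaleDr : right_distributive pmod_scale +%R.
Proof.
move=> c t u; apply: pmod_ext => V f Hf.
by rewrite lift_scale // !lift_add // scalerDr !lift_scale.
Qed.
Lemma pmod_scaleDl (t : pmod) : {morph pmod_scale^~ t : a b / a + b}.
Proof.
move=> a b; apply: pmod_ext => V f Hf.
by rewrite lift_scale // lift_add // !lift_scale // scalerDl.
Qed.

HB.instance Definition _ := GRing.Zmodule_isLmodule.Build C pmod
  pmod_scaleA pmod_scale1 pmod_scaleDr pmod_scaleDl.

Lemma pmod_lift_linear (V : lmodType C) (f : X -> V) : adm f -> linear (pmod_lift f).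
Proof. by move=> Hf c t u; rewrite [LHS]lift_add // lift_scale. Qed.

Lemma pmod_lift_gen (V : lmodType C) (f : X -> V) x :
  adm f -> pmod_lift f (pmod_gen x) = f x.
Proof. by move=> Hf; rewrite pmod_lift_of // /pmod_eval big_seq1 scale1r. Qed.

Lemma pmod_ext_gen (V : lmodType C) (f g : pmod -> V) :
  linear f -> linear g ->
  (forall x, f (pmod_gen x) = g (pmod_gen x)) -> f =1 g.
Proof.
move=> Hf Hg H.
have f0 : f 0 = 0.
  by have := Hf (-1) 0 0; rewrite scaler0 add0r scaleN1r addNr.
have g0 : g 0 = 0.
  by have := Hg (-1) 0 0; rewrite scaler0 add0r scaleN1r addNr.
have E s : pmod_of s = \sum_(p <- s) p.1 *: pmod_gen p.2.
  apply: pmod_ext => V' k Hk.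
  rewrite pmod_lift_of // /pmod_eval; elim: s => [|p s IH].
    by rewrite !big_nil lift_zero.
  by rewrite !big_cons pmod_lift_linear // IH pmod_lift_gen.
move=> t; rewrite -[t]reprK [\pi_ _ _](E (repr t)).
elim: (repr t) => [|p s IH]; first by rewrite !big_nil f0 g0.
by rewrite big_cons Hf Hg H IH.
Qed.

End PresentedModule.

Definition antilinear (C : numClosedFieldType) (U V : lmodType C) (f : U -> V) : Prop :=
  forall (c : C) (x y : U), f (c *: x + y) = c^* *: f x + f y.

(* V with the conjugate scalar multiplication: antilinear maps into V are     *)
(* linear maps into [conj_lmod V], so they too descend to tensor products.    *)
Section ConjugateModule.
Variables (C : numClosedFieldType) (V : lmodType C).
Definition conj_lmod : Type := V.
HB.instance Definition _ := GRing.Zmodule.on conj_lmod.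
Definition conj_scale (c : C) (x : conj_lmod) : conj_lmod := (c^* *: (x : V) : V).
Fact conj_scaleA a b x : conj_scale a (conj_scale b x) = conj_scale (a * b) x.
Proof. by rewrite /conj_scale scalerA rmorphM. Qed.
Fact conj_scale1 : left_id 1 conj_scale.
Proof. by move=> x; rewrite /conj_scale rmorph1 scale1r. Qed.
Fact conj_scaleDr : right_distributive conj_scale +%R.
Proof. by move=> c x y; rewrite /conj_scale [LHS]scalerDr. Qed.
Fact conj_scaleDl x : {morph conj_scale^~ x : a b / a + b}.
Proof. by move=> a b; rewrite /conj_scale rmorphD scalerDl. Qed.
HB.instance Definition _ := GRing.Zmodule_isLmodule.Build C conj_lmod
  conj_scaleA conj_scale1 conj_scaleDr conj_scaleDl.
End ConjugateModule.

(* The tensor product of M and N over K, for arbitrary actions of K.          *)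
Section TensorProduct.
Variables (C : numClosedFieldType) (M N : lmodType C) (K : Type).
Variables (ra : M -> K -> M) (la : K -> N -> N).

Definition balanced (V : lmodType C) (f : M * N -> V) : Prop :=
  [/\ forall y, linear (fun x => f (x, y)),
      forall x, linear (fun y => f (x, y)) &
      forall x k y, f (ra x k, y) = f (x, la k y)].

Definition tens := pmod balanced.
HB.instance Definition _ := GRing.Lmodule.on tens.

Definition tpure (x : M) (y : N) : tens := pmod_gen balanced (x, y).

Lemma tpure_linl y : linear (tpure ^~ y).
Proof.
move=> c x x'; apply: pmod_ext => V f Hf; have [H _ _] := Hf.
by rewrite pmod_lift_linear // !pmod_lift_gen //; apply: H.
Qed.

Lemma tpure_linr x : linear (tpure x).
Proof.
move=> c y y'; apply: pmod_ext => V f Hf; have [_ H _] := Hf.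
by rewrite pmod_lift_linear // !pmod_lift_gen //; apply: H.
Qed.

Lemma tpure_bal x k y : tpure (ra x k) y = tpure x (la k y).
Proof.
by apply: pmod_ext => V f Hf; have [_ _ H] := Hf; rewrite !pmod_lift_gen.
Qed.

(* Sweedler sums: [texp t F] sums F over a chosen decomposition of t into     *)
(* pure tensors; independent of the choice when F is balanced and linear or   *)
(* antilinear in each argument.                                               *)
Definition tdecomp (t : tens) : seq (M * N) :=
  [seq (p.1 *: (p.2 : M * N).1, (p.2 : M * N).2) | p <- repr t].

Definition texp (V : zmodType) (t : tens) (F : M -> N -> V) : V :=
  \sum_(p <- tdecomp t) F p.1 p.2.

Lemma texp_lift (V : lmodType C) (F : M -> N -> V) (t : tens) :
  balanced (fun p => F p.1 p.2) -> texp t F = pmod_lift (fun p => F p.1 p.2) t.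
Proof.
move=> [H _ _]; rewrite /texp /tdecomp big_map; apply: eq_bigr => -[c [x y]] _ /=.
have F0 : F 0 y = 0.
  by have := H y (-1) 0 0; rewrite /= scaler0 add0r scaleN1r addNr.
by have := H y c x 0; rewrite /= !addr0 F0 addr0.
Qed.

Lemma texp_linear (V : lmodType C) (F : M -> N -> V) :
  balanced (fun p => F p.1 p.2) -> linear (fun t => texp t F).
Proof. by move=> HF c t u; rewrite !texp_lift // pmod_lift_linear. Qed.

Lemma texp_pure (V : lmodType C) (F : M -> N -> V) x y :
  balanced (fun p => F p.1 p.2) -> texp (tpure x y) F = F x y.
Proof. by move=> HF; rewrite texp_lift // pmod_lift_gen. Qed.

Definition antibalanced (V : lmodType C) (F : M -> N -> V) : Prop :=
  [/\ forall y, antilinear (F ^~ y), forall x, antilinear (F x) &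
      forall x k y, F (ra x k) y = F x (la k y)].

Lemma antibalancedE (V : lmodType C) (F : M -> N -> V) :
  antibalanced F -> balanced (fun p => F p.1 p.2 : conj_lmod V).
Proof. by case=> H1 H2 H3; split=> [y c x x'|x c y y'|x k y] /=; [apply: H1|apply: H2|]. Qed.

Lemma texp_antilinear (V : lmodType C) (F : M -> N -> V) :
  antibalanced F -> antilinear (fun t => texp t F).
Proof. by move=> /antibalancedE/texp_linear. Qed.

Lemma texp_pure_anti (V : lmodType C) (F : M -> N -> V) x y :
  antibalanced F -> texp (tpure x y) F = F x y.
Proof. by move=> /antibalancedE/(texp_pure x y). Qed.

Lemma tens_ext (V : lmodType C) (f g : tens -> V) : linear f -> linear g ->
  (forall x y, f (tpure x y) = g (tpure x y)) -> f =1 g.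
Proof. by move=> Hf Hg H; apply: pmod_ext_gen => // -[x y]; apply: H. Qed.

Lemma tpure_balanced : balanced (fun p => tpure p.1 p.2).
Proof.
by split=> [y|x|x k y]; [apply: tpure_linl|apply: tpure_linr|apply: tpure_bal].
Qed.

Lemma tdecompE (t : tens) : t = \sum_(p <- tdecomp t) tpure p.1 p.2.
Proof.
apply: (tens_ext (f := id) (g := fun t => texp t tpure)) => //.
  by apply: texp_linear; exact: tpure_balanced.
by move=> x y; rewrite texp_pure //; exact: tpure_balanced.
Qed.

Lemma texp_lin (V : lmodType C) (c : C) (F G H : M -> N -> V) (t : tens) :
  (forall x y, F x y = c *: G x y + H x y) ->
  texp t F = c *: texp t G + texp t H.
Proof.
move=> E; rewrite /texp scaler_sumr -big_split.
by apply: eq_bigr => p _; rewrite E.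
Qed.

End TensorProduct.

Notation "\tsum_ ( x ⊗ y <- t ) E" := (texp t (fun x y => E))
  (at level 41, x name, y name, E at level 41, right associativity,
   format "'[' \tsum_ ( x  ⊗  y  <-  t ) '/  '  E ']'") : ring_scope.

Definition ctens (C : numClosedFieldType) (M N : lmodType C) : lmodType C :=
  @tens C M N C (fun x c => c *: x) (fun c y => c *: y).
Definition ctpure (C : numClosedFieldType) (M N : lmodType C) (x : M) (y : N) :
  ctens M N := tpure _ _ x y.
Notation "x ⊗ y" := (ctpure x y) (at level 38, right associativity) : ring_scope.

Record bimodule (C : numClosedFieldType) (A : algType C) := Bimodule {
  bim_car :> lmodType C;
  lact : A -> bim_car -> bim_car;
  ract : bim_car -> A -> bim_car;
  lact_linl : forall x, linear (lact ^~ x);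
  lact_linr : forall a, linear (lact a);
  ract_linl : forall a, linear (ract ^~ a);
  ract_linr : forall x, linear (ract x);
  lact1 : forall x, lact 1 x = x;
  lactM : forall a b x, lact (a * b) x = lact a (lact b x);
  ract1 : forall x, ract x 1 = x;
  ractM : forall x a b, ract x (a * b) = ract (ract x a) b;
  lractC : forall a x b, ract (lact a x) b = lact a (ract x b) }.
Arguments lact {C A _} _ _.
Arguments ract {C A _} _ _.
Notation "a ·l x" := (lact a x) (at level 34, right associativity) : ring_scope.
Notation "x ·r a" := (ract x a) (at level 33, left associativity) : ring_scope.

Section RegularBimodule.
Variables (C : numClosedFieldType) (A : algType C).
Fact reg_linl (x : A) : linear (fun a : A => a * x).
Proof. by move=> c a b; rewrite mulrDl scalerAl. Qed.
Fact reg_linr (x : A) : linear (fun a : A => x * a).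
Proof. by move=> c a b; rewrite mulrDr scalerAr. Qed.
Definition reg_bimodule : bimodule A :=
  @Bimodule C A A (fun a x => a * x) (fun x a => x * a)
    reg_linl reg_linr reg_linl reg_linr
    (@mul1r A) (fun a b x => esym (mulrA a b x)) (@mulr1 A) (@mulrA A)
    (fun a x b => esym (mulrA a x b)).
End RegularBimodule.

Section BalancedTensor.
Variables (C : numClosedFieldType) (A : algType C) (M N : bimodule A).

Definition btens_lmod : lmodType C :=
  @tens C M N A (fun x a => x ·r a) (fun a y => a ·l y).
Definition btens_pure (x : M) (y : N) : btens_lmod := tpure _ _ x y.
Definition btens_lact (a : A) (t : btens_lmod) : btens_lmod :=
  \tsum_(x ⊗ y <- t) btens_pure (a ·l x) y.
Definition btens_ract (t : btens_lmod) (a : A) : btens_lmod :=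
  \tsum_(x ⊗ y <- t) btens_pure x (y ·r a).

Let lact_bal a : balanced (fun (x : M) (a : A) => x ·r a) (fun a (y : N) => a ·l y)
  (fun p => btens_pure (a ·l p.1) p.2).
Proof.
split=> [y c x x'|x c y y'|x k y] /=.
- by rewrite lact_linr [LHS]tpure_linl.
- exact: tpure_linr.
- by rewrite -lractC [LHS]tpure_bal.
Qed.
Let ract_bal a : balanced (fun (x : M) (a : A) => x ·r a) (fun a (y : N) => a ·l y)
  (fun p => btens_pure p.1 (p.2 ·r a)).
Proof.
split=> [y c x x'|x c y y'|x k y] /=.
- exact: tpure_linl.
- by rewrite ract_linl [LHS]tpure_linr.
- by rewrite [LHS]tpure_bal lractC.
Qed.

Lemma btens_lact_pure a x y : btens_lact a (btens_pure x y) = btens_pure (a ·l x) y.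
Proof. exact: texp_pure (lact_bal a). Qed.
Lemma btens_ract_pure a x y : btens_ract (btens_pure x y) a = btens_pure x (y ·r a).
Proof. exact: texp_pure (ract_bal a). Qed.

Fact btens_lact_linl t : linear (btens_lact ^~ t).
Proof.
by move=> c a b; apply: texp_lin => x y; rewrite lact_linl [LHS]tpure_linl.
Qed.
Fact btens_lact_linr a : linear (btens_lact a).
Proof. exact: texp_linear. Qed.
Fact btens_ract_linl a : linear (btens_ract ^~ a).
Proof. exact: texp_linear. Qed.
Fact btens_ract_linr t : linear (btens_ract t).
Proof.
by move=> c a b; apply: texp_lin => x y; rewrite ract_linr [LHS]tpure_linr.
Qed.

Lemma btens_ext (V : lmodType C) (f g : btens_lmod -> V) : linear f -> linear g ->
  (forall x y, f (btens_pure x y) = g (btens_pure x y)) -> f =1 g.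
Proof. exact: tens_ext. Qed.

Fact btens_lact1 t : btens_lact 1 t = t.
Proof.
apply: (btens_ext (g := id)) t => //; first exact: btens_lact_linr.
by move=> x y; rewrite btens_lact_pure lact1.
Qed.
Fact btens_lactM a b t : btens_lact (a * b) t = btens_lact a (btens_lact b t).
Proof.
apply: (btens_ext (f := btens_lact (a * b)) (g := fun t => btens_lact a (btens_lact b t))) t.
- exact: btens_lact_linr.
- by move=> c t u; rewrite !btens_lact_linr.
- by move=> x y; rewrite !btens_lact_pure lactM.
Qed.
Fact btens_ract1 t : btens_ract t 1 = t.
Proof.
apply: (btens_ext (f := btens_ract ^~ 1) (g := id)) t => //.
  exact: btens_ract_linl.
by move=> x y; rewrite btens_ract_pure ract1.
Qed.
Fact btens_ractM t a b : btens_ract t (a * b) = btens_ract (btens_ract t a) b.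
Proof.
apply: (btens_ext (f := btens_ract ^~ (a * b)) (g := fun t => btens_ract (btens_ract t a) b)) t.
- exact: btens_ract_linl.
- by move=> c t u; rewrite !btens_ract_linl.
- by move=> x y; rewrite !btens_ract_pure ractM.
Qed.
Fact btens_lractC a t b : btens_ract (btens_lact a t) b = btens_lact a (btens_ract t b).
Proof.
apply: (btens_ext (f := fun t => btens_ract (btens_lact a t) b)
                  (g := fun t => btens_lact a (btens_ract t b))) t.
- by move=> c t u; rewrite btens_lact_linr btens_ract_linl.
- by move=> c t u; rewrite btens_ract_linl btens_lact_linr.
- by move=> x y; rewrite !(btens_lact_pure, btens_ract_pure).
Qed.

Definition btens : bimodule A :=
  Bimodule btens_lact_linl btens_lact_linr btens_ract_linl btens_ract_linr
    btens_lact1 btens_lactM btens_ract1 btens_ractM btens_lractC.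
Definition btpure (x : M) (y : N) : btens := btens_pure x y.

End BalancedTensor.
Notation "x ⊙ y" := (btpure x y) (at level 38, right associativity) : ring_scope.

Section TensorAlgebra.
Variables (C : numClosedFieldType) (A : algType C) (M : bimodule A).

(* The tensor power M^{⊗k} over A, M^{⊗0} being A.                            *)
Fixpoint tpow (k : nat) : bimodule A :=
  if k is k'.+1 then btens M (tpow k') else reg_bimodule A.

(* The direct sum of the tensor powers, as the coproduct of these modules.    *)
Definition dsum_adm (V : lmodType C) (f : {k : nat & tpow k} -> V) : Prop :=
  forall k, linear (fun x : tpow k => f (existT _ k x)).

Definition talg := pmod dsum_adm.
HB.instance Definition _ := GRing.Lmodule.on talg.

Definition tin (k : nat) (x : tpow k) : talg := pmod_gen dsum_adm (existT _ k x).

Lemma tin_linear k : linear (@tin k).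
Proof.
move=> c x y; apply: pmod_ext => V f Hf.
by rewrite pmod_lift_linear // !pmod_lift_gen //; apply: Hf.
Qed.

Fixpoint tpow_mul (k l : nat) {struct k} : tpow k -> tpow l -> tpow (k + l) :=
  match k return tpow k -> tpow l -> tpow (k + l) with
  | 0 => fun a y => a ·l y
  | k'.+1 => fun t y => \tsum_(m ⊗ x <- t) m ⊙ tpow_mul (k := k') x y
  end.

Definition talg_mul (t u : talg) : talg :=
  pmod_lift (fun p => pmod_lift (fun q => tin (tpow_mul (projT2 p) (projT2 q))) u) t.
Definition talg_one : talg := tin (k := 0) (1 : A).

Lemma btpure_linl (N P : bimodule A) (y : P) : linear (fun x : N => x ⊙ y).
Proof. exact: tpure_linl. Qed.
Lemma btpure_linr (N P : bimodule A) (x : N) : linear (fun y : P => x ⊙ y).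
Proof. exact: tpure_linr. Qed.
Lemma btpure_bal (N P : bimodule A) (x : N) a (y : P) : (x ·r a) ⊙ y = x ⊙ (a ·l y).
Proof. exact: tpure_bal. Qed.
Lemma lact_btpure (N P : bimodule A) (x : N) a (y : P) : a ·l (x ⊙ y) = (a ·l x) ⊙ y.
Proof. exact: btens_lact_pure. Qed.
Lemma ract_btpure (N P : bimodule A) (x : N) a (y : P) : (x ⊙ y) ·r a = x ⊙ (y ·r a).
Proof. exact: btens_ract_pure. Qed.

Lemma tpow_mulE k l (t : tpow k.+1) (y : tpow l) :
  tpow_mul (k := k.+1) t y = \tsum_(m ⊗ x <- (t : btens M (tpow k))) m ⊙ tpow_mul x y.
Proof. by []. Qed.

Lemma tpow_mul_spec k l :
  [/\ forall y, linear (fun x : tpow k => @tpow_mul k l x y),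
      forall x, linear (@tpow_mul k l x) &
      forall a x y, @tpow_mul k l (a ·l x) y = a ·l tpow_mul x y].
Proof.
elim: k => [|k [IHl IHr IHa]].
  by split=> [y|x|a x y]; [exact: lact_linl|exact: lact_linr|exact: lactM].
have bal y : balanced (fun (x : M) (a : A) => x ·r a) (fun a (y : tpow k) => a ·l y)
    (fun p => p.1 ⊙ tpow_mul p.2 y : btens M (tpow (k + l))).
  split=> [x c m m'|m c x x'|m a x] /=.
  - exact: btpure_linl.
  - by rewrite IHl btpure_linr.
  - by rewrite btpure_bal IHa.
split=> [y|x c y y'|a x y].
- exact: texp_linear.
- by rewrite !tpow_mulE; apply: texp_lin => m z; rewrite IHr btpure_linr.
- apply: (@btens_ext _ _ M (tpow k) (btens M (tpow (k + l)))
    (fun x : btens M (tpow k) => \tsum_(m ⊗ z <- @lact _ _ (btens M (tpow k)) a x) m ⊙ tpow_mul z y)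
    (fun x : btens M (tpow k) => a ·l (\tsum_(m ⊗ z <- x) m ⊙ tpow_mul z y))) x.
  + by move=> c t u; rewrite lact_linr (texp_linear (bal y)).
  + by move=> c t u; rewrite (texp_linear (bal y)) lact_linr.
  + move=> m z; rewrite -[btens_pure m z]/(m ⊙ z) lact_btpure.
    by rewrite !(texp_pure _ _ (bal y)) lact_btpure.
Qed.

Lemma tpow_mulS k l (m : M) (x : tpow k) (y : tpow l) :
  tpow_mul (k := k.+1) (m ⊙ x) y = m ⊙ tpow_mul x y.
Proof.
apply: (@texp_pure _ _ _ _ _ _ (btens M (tpow (k + l)))
  (fun m x => m ⊙ tpow_mul x y)).
have [IHl IHr IHa] := tpow_mul_spec k l.
split=> [z c m1 m'|m1 c z x'|m1 a z] /=.
- exact: btpure_linl.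
- by rewrite IHl btpure_linr.
- by rewrite btpure_bal IHa.
Qed.

Lemma talg_mul_adm2 k (x : tpow k) :
  dsum_adm (fun q : {l : nat & tpow l} => tin (tpow_mul x (projT2 q))).
Proof. by move=> l c y y' /=; have [_ -> _] := tpow_mul_spec k l; rewrite tin_linear. Qed.

Lemma talg_mul_adm1 u : dsum_adm
  (fun p : {k : nat & tpow k} =>
     pmod_lift (fun q : {l : nat & tpow l} => tin (tpow_mul (projT2 p) (projT2 q))) (u : talg)).
Proof.
move=> k c x x' /=; rewrite /pmod_lift /pmod_eval scaler_sumr -big_split.
apply: eq_bigr => -[d [l y]] _ /=.
have [-> _ _] := tpow_mul_spec k l.
by rewrite tin_linear scalerDr !scalerA mulrC.
Qed.

Lemma talg_mul_linl u : linear (talg_mul ^~ u).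
Proof. exact: pmod_lift_linear (talg_mul_adm1 u). Qed.

Lemma talg_mul_linr t : linear (talg_mul t).
Proof.
move=> c u u'; rewrite /talg_mul /pmod_lift /pmod_eval scaler_sumr -big_split.
apply: eq_bigr => -[d [k x]] _ /=.
have := pmod_lift_linear (talg_mul_adm2 x) c u u'; rewrite /pmod_lift /pmod_eval => ->.
by rewrite scalerDr !scalerA mulrC.
Qed.

Lemma talg_mul_tin k l (x : tpow k) (y : tpow l) :
  talg_mul (tin x) (tin y) = tin (tpow_mul x y).
Proof.
rewrite /talg_mul pmod_lift_gen; last exact: talg_mul_adm1.
by rewrite pmod_lift_gen //; exact: talg_mul_adm2.
Qed.

Lemma talg_ext (V : lmodType C) (f g : talg -> V) : linear f -> linear g ->
  (forall k (x : tpow k), f (tin x) = g (tin x)) -> f =1 g.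
Proof. by move=> Hf Hg H; apply: pmod_ext_gen => // -[k x]; apply: H. Qed.

Let graft (m : M) (t : talg) : talg :=
  pmod_lift (fun p : {k : nat & tpow k} => tin (k := (projT1 p).+1) (m ⊙ projT2 p)) t.
Let graft_tin m k (x : tpow k) : graft m (tin x) = tin (k := k.+1) (m ⊙ x).
Proof.
by apply: pmod_lift_gen => l c y y' /=; rewrite btpure_linr tin_linear.
Qed.

Lemma tpow_mulA k l n (x : tpow k) (y : tpow l) (z : tpow n) :
  tin (tpow_mul x (tpow_mul y z)) = tin (tpow_mul (tpow_mul x y) z).
Proof.
elim: k x => [|k IH] x /=.
  by have [_ _ ->] := tpow_mul_spec l n.
apply: (@btens_ext _ _ M (tpow k) talg
  (fun x : btens M (tpow k) => tin (tpow_mul (k := k.+1) x (tpow_mul y z)))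
  (fun x : btens M (tpow k) => tin (tpow_mul (k := (k + l).+1) (tpow_mul (k := k.+1) x y) z))) x.
- by move=> c t u; have [-> _ _] := tpow_mul_spec k.+1 (l + n); rewrite tin_linear.
- move=> c t u; have [-> _ _] := tpow_mul_spec k.+1 l.
  by have [-> _ _] := tpow_mul_spec (k + l).+1 n; rewrite tin_linear.
- move=> m x; rewrite [tpow_mul (k := k.+1) _ _]tpow_mulS [tpow_mul (k := k.+1) _ y]tpow_mulS.
  by rewrite [tpow_mul (k := (k + l).+1) _ z]tpow_mulS -!graft_tin IH.
Qed.

Lemma tpow_mulx1 k (x : tpow k) : tin (tpow_mul (l := 0) x (1 : A)) = tin x.
Proof.
elim: k x => [|k IH] x /=; first by rewrite mulr1.
apply: (@btens_ext _ _ M (tpow k) talg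
  (fun x : btens M (tpow k) => tin (tpow_mul (k := k.+1) (l := 0) x (1 : A)))
  (fun x : btens M (tpow k) => tin (k := k.+1) x)) x.
- by move=> c t u; have [-> _ _] := tpow_mul_spec k.+1 0; rewrite tin_linear.
- exact: (@tin_linear k.+1).
- by move=> m x; rewrite [tpow_mul (k := k.+1) _ _]tpow_mulS -!graft_tin IH.
Qed.

Fact talg_mulDl : left_distributive talg_mul +%R.
Proof. by move=> t u v; have := talg_mul_linl v 1 t u; rewrite !scale1r. Qed.
Fact talg_mulDr : right_distributive talg_mul +%R.
Proof. by move=> t u v; have := talg_mul_linr t 1 u v; rewrite !scale1r. Qed.

Fact talg_mulA : associative talg_mul.
Proof.
move=> t u v.
apply: (talg_ext (f := fun t => talg_mul t (talg_mul u v))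
                 (g := fun t => talg_mul (talg_mul t u) v)) t.
- exact: talg_mul_linl.
- by move=> c t t'; rewrite !talg_mul_linl.
move=> k x.
apply: (talg_ext (f := fun u => talg_mul (tin x) (talg_mul u v))
                 (g := fun u => talg_mul (talg_mul (tin x) u) v)) u.
- by move=> c t t'; rewrite talg_mul_linl talg_mul_linr.
- by move=> c t t'; rewrite talg_mul_linr talg_mul_linl.
move=> l y.
apply: (talg_ext (f := fun v => talg_mul (tin x) (talg_mul (tin y) v))
                 (g := fun v => talg_mul (talg_mul (tin x) (tin y)) v)) v.
- by move=> c t t'; rewrite !talg_mul_linr.
- exact: talg_mul_linr.
by move=> n z; rewrite !talg_mul_tin tpow_mulA.
Qed.

Fact talg_mul1 : left_id talg_one talg_mul.
Proof.
apply: talg_ext => //; first exact: talg_mul_linr.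
by move=> k x; rewrite talg_mul_tin /= lact1.
Qed.
Fact talg_mulr1 : right_id talg_one talg_mul.
Proof.
apply: (talg_ext (f := talg_mul ^~ talg_one)) => //; first exact: talg_mul_linl.
by move=> k x; rewrite talg_mul_tin tpow_mulx1.
Qed.

HB.instance Definition _ := GRing.Zmodule_isPzRing.Build talg
  talg_mulA talg_mul1 talg_mulr1 talg_mulDl talg_mulDr.

Lemma talg_scaleAl (c : C) (t u : talg) : c *: (t * u) = (c *: t) * u.
Proof.
have := talg_mul_linl u c t 0; rewrite addr0 => E.
by apply/esym; rewrite [LHS]E (mul0r u : talg_mul 0 u = 0) addr0.
Qed.
Lemma talg_scaleAr (c : C) (t u : talg) : c *: (t * u) = t * (c *: u).
Proof.
have := talg_mul_linr t c u 0; rewrite addr0 => E.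
by apply/esym; rewrite [LHS]E (mulr0 t : talg_mul t 0 = 0) addr0.
Qed.

Definition tscal (a : A) : talg := tin (k := 0) a.
Definition tvec (m : M) : talg := tin (k := 1) (m ⊙ (1 : reg_bimodule A)).
Definition tvec2 (r : btens M M) : talg := \tsum_(m ⊗ m' <- r) tvec m * tvec m'.

End TensorAlgebra.

Section CliffordAlgebra.
Variables (C : numClosedFieldType) (A : algType C) (M : bimodule A).
Variables (sigma : btens M M -> btens M M) (g : btens M M -> A).

(* The two-sided ideal generated by r - g(r), where sigma(r) = r.             *)
Definition cl_ideal (t : talg M) : Prop :=
  exists s : seq (talg M * btens M M * talg M),
    (forall p, p \in s -> sigma p.1.2 = p.1.2) /\
    t = \sum_(p <- s) p.1.1 * (tvec2 p.1.2 - tscal M (g p.1.2)) * p.2.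

Lemma cl_ideal0 : cl_ideal 0.
Proof. by exists [::]; rewrite big_nil. Qed.
Lemma cl_idealD t u : cl_ideal t -> cl_ideal u -> cl_ideal (t + u).
Proof.
move=> [s [Hs ->]] [s' [Hs' ->]]; exists (s ++ s'); rewrite big_cat; split=> // p.
by rewrite mem_cat => /orP[/Hs|/Hs'].
Qed.
Lemma cl_idealMl v t : cl_ideal t -> cl_ideal (v * t).
Proof.
move=> [s [Hs ->]]; exists [seq (v * p.1.1, p.1.2, p.2) | p <- s]; split.
  by move=> p /mapP[q /Hs Hq ->].
by rewrite big_map mulr_sumr; apply: eq_bigr => p _; rewrite !mulrA.
Qed.
Lemma cl_idealMr v t : cl_ideal t -> cl_ideal (t * v).
Proof.
move=> [s [Hs ->]]; exists [seq (p.1.1, p.1.2, p.2 * v) | p <- s]; split.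
  by move=> p /mapP[q /Hs Hq ->].
by rewrite big_map mulr_suml; apply: eq_bigr => p _; rewrite !mulrA.
Qed.
Lemma cl_idealN t : cl_ideal t -> cl_ideal (- t).
Proof. by rewrite -mulN1r; apply: cl_idealMl. Qed.
Lemma cl_idealZ c t : cl_ideal t -> cl_ideal (c *: t).
Proof. by rewrite -[t]mul1r talg_scaleAl mul1r; apply: cl_idealMl. Qed.

Definition cl_rel (t u : talg M) : bool := `[< cl_ideal (t - u) >].

Lemma cl_rel_equiv : equiv_class_of cl_rel.
Proof.
split=> [t|t u|t u v].
- by apply/asboolP; rewrite subrr; exact: cl_ideal0.
- by apply/asboolP/asboolP => /cl_idealN; rewrite opprB.
- move=> /asboolP H1 /asboolP H2; apply/asboolP.
  by have := cl_idealD H1 H2; rewrite addrA subrK.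
Qed.
Canonical cl_equiv := EquivRelPack cl_rel_equiv.

Definition Cl := {eq_quot cl_equiv}.
HB.instance Definition _ := Choice.on Cl.

Definition cl_pi (t : talg M) : Cl := \pi_Cl t.

Lemma cl_piP t u : cl_pi t = cl_pi u <-> cl_ideal (t - u).
Proof. by split=> [/eqquotP/asboolP|H]; last apply/eqquotP/asboolP. Qed.

Lemma cl_pi_repr (x : Cl) : cl_pi (repr x) = x.
Proof. exact: reprK. Qed.

Lemma cl_ideal_repr t : cl_ideal (repr (cl_pi t) - t).
Proof. by apply/cl_piP; rewrite cl_pi_repr. Qed.

Definition cl_add (x y : Cl) : Cl := cl_pi (repr x + repr y).
Definition cl_opp (x : Cl) : Cl := cl_pi (- repr x).
Definition cl_scale (c : C) (x : Cl) : Cl := cl_pi (c *: repr x).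
Definition cl_mul (x y : Cl) : Cl := cl_pi (repr x * repr y).

Lemma cl_add_pi t u : cl_add (cl_pi t) (cl_pi u) = cl_pi (t + u).
Proof.
apply/cl_piP; rewrite opprD addrACA.
by apply: cl_idealD; exact: cl_ideal_repr.
Qed.
Lemma cl_opp_pi t : cl_opp (cl_pi t) = cl_pi (- t).
Proof.
apply/cl_piP; rewrite -opprD.
by apply: cl_idealN; exact: cl_ideal_repr.
Qed.
Lemma cl_scale_pi c t : cl_scale c (cl_pi t) = cl_pi (c *: t).
Proof.
apply/cl_piP; rewrite -scalerBr.
by apply: cl_idealZ; exact: cl_ideal_repr.
Qed.
Lemma cl_mul_pi t u : cl_mul (cl_pi t) (cl_pi u) = cl_pi (t * u).
Proof.
apply/cl_piP.
have -> : repr (cl_pi t) * repr (cl_pi u) - t * u =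
  (repr (cl_pi t) - t) * repr (cl_pi u) + t * (repr (cl_pi u) - u).
  by rewrite mulrBl mulrBr addrA subrK.
by apply: cl_idealD; [apply: cl_idealMr|apply: cl_idealMl]; exact: cl_ideal_repr.
Qed.

Lemma cl_ind (P : Cl -> Prop) : (forall t, P (cl_pi t)) -> forall x, P x.
Proof. by move=> H x; rewrite -(cl_pi_repr x). Qed.

Fact cl_addA : associative cl_add.
Proof.
by elim/cl_ind=> t; elim/cl_ind=> u; elim/cl_ind=> v; rewrite !cl_add_pi addrA.
Qed.
Fact cl_addC : commutative cl_add.
Proof. by elim/cl_ind=> t; elim/cl_ind=> u; rewrite !cl_add_pi addrC. Qed.
Fact cl_add0 : left_id (cl_pi 0) cl_add.
Proof. by elim/cl_ind=> t; rewrite cl_add_pi add0r. Qed.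
Fact cl_addN : left_inverse (cl_pi 0) cl_opp cl_add.
Proof. by elim/cl_ind=> t; rewrite cl_opp_pi cl_add_pi addNr. Qed.
HB.instance Definition _ := GRing.isZmodule.Build Cl cl_addA cl_addC cl_add0 cl_addN.

Fact cl_scaleA a b x : cl_scale a (cl_scale b x) = cl_scale (a * b) x.
Proof. by elim/cl_ind: x => t; rewrite !cl_scale_pi scalerA. Qed.
Fact cl_scale1 : left_id 1 cl_scale.
Proof. by elim/cl_ind=> t; rewrite cl_scale_pi scale1r. Qed.
Fact cl_scaleDr : right_distributive cl_scale +%R.
Proof.
move=> c; elim/cl_ind=> t; elim/cl_ind=> u.
by rewrite [_ + _]cl_add_pi !cl_scale_pi [RHS]cl_add_pi scalerDr.
Qed.
Fact cl_scaleDl x : {morph cl_scale^~ x : a b / a + b}.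
Proof.
by move=> a b; elim/cl_ind: x => t; rewrite !cl_scale_pi [RHS]cl_add_pi scalerDl.
Qed.
HB.instance Definition _ := GRing.Zmodule_isLmodule.Build C Cl
  cl_scaleA cl_scale1 cl_scaleDr cl_scaleDl.

Fact cl_mulA : associative cl_mul.
Proof.
by elim/cl_ind=> t; elim/cl_ind=> u; elim/cl_ind=> v; rewrite !cl_mul_pi mulrA.
Qed.
Fact cl_mul1 : left_id (cl_pi 1) cl_mul.
Proof. by elim/cl_ind=> t; rewrite cl_mul_pi mul1r. Qed.
Fact cl_mulr1 : right_id (cl_pi 1) cl_mul.
Proof. by elim/cl_ind=> t; rewrite cl_mul_pi mulr1. Qed.
Fact cl_mulDl : left_distributive cl_mul +%R.
Proof.
elim/cl_ind=> t; elim/cl_ind=> u; elim/cl_ind=> v.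
by rewrite [_ + _]cl_add_pi !cl_mul_pi [RHS]cl_add_pi mulrDl.
Qed.
Fact cl_mulDr : right_distributive cl_mul +%R.
Proof.
elim/cl_ind=> t; elim/cl_ind=> u; elim/cl_ind=> v.
by rewrite [_ + _]cl_add_pi !cl_mul_pi [RHS]cl_add_pi mulrDr.
Qed.
HB.instance Definition _ := GRing.Zmodule_isPzRing.Build Cl
  cl_mulA cl_mul1 cl_mulr1 cl_mulDl cl_mulDr.

Fact cl_pi_linear : linear cl_pi.
Proof. by move=> c t u; rewrite -[c *: cl_pi t]/(cl_scale c (cl_pi t)) cl_scale_pi [RHS]cl_add_pi. Qed.
HB.instance Definition _ :=
  GRing.isLinear.Build C (talg M) Cl *:%R cl_pi cl_pi_linear.
Fact cl_pi_monoid : monoid_morphism cl_pi.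
Proof. by split=> // t u; rewrite [RHS]cl_mul_pi. Qed.
HB.instance Definition _ :=
  GRing.isMonoidMorphism.Build (talg M) Cl cl_pi cl_pi_monoid.

Lemma cl_scaleAl (c : C) (x y : Cl) : c *: (x * y) = (c *: x) * y.
Proof.
elim/cl_ind: x => t; elim/cl_ind: y => u.
by rewrite -rmorphM -!linearZ -rmorphM /= talg_scaleAl.
Qed.
Lemma cl_scaleAr (c : C) (x y : Cl) : c *: (x * y) = x * (c *: y).
Proof.
elim/cl_ind: x => t; elim/cl_ind: y => u.
by rewrite -rmorphM -!linearZ -rmorphM /= talg_scaleAr.
Qed.

Definition cl_scal (a : A) : Cl := cl_pi (tscal M a).
Definition cl_vec (m : M) : Cl := cl_pi (tvec m).

Lemma cl_scal_linear : linear cl_scal.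
Proof. by move=> c a b; rewrite /cl_scal /tscal tin_linear linearP. Qed.
Lemma cl_scal1 : cl_scal 1 = 1.
Proof. exact: rmorph1. Qed.
Lemma cl_scalM a b : cl_scal (a * b) = cl_scal a * cl_scal b.
Proof. by rewrite /cl_scal -rmorphM [tscal _ a * _]talg_mul_tin. Qed.

Fact cl_linl (u : Cl) : linear (fun a => cl_scal a * u).
Proof. by move=> c a b; rewrite cl_scal_linear mulrDl -cl_scaleAl. Qed.
Fact cl_linr (a : A) : linear (fun u : Cl => cl_scal a * u).
Proof. by move=> c u v; rewrite mulrDr -cl_scaleAr. Qed.
Fact cl_rlinl (a : A) : linear (fun u : Cl => u * cl_scal a).
Proof. by move=> c u v; rewrite mulrDl -cl_scaleAl. Qed.
Fact cl_rlinr (u : Cl) : linear (fun a => u * cl_scal a).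
Proof. by move=> c a b; rewrite cl_scal_linear mulrDr -cl_scaleAr. Qed.
Fact cl_lact1 (u : Cl) : cl_scal 1 * u = u.
Proof. by rewrite cl_scal1 mul1r. Qed.
Fact cl_lactM a b (u : Cl) : cl_scal (a * b) * u = cl_scal a * (cl_scal b * u).
Proof. by rewrite cl_scalM mulrA. Qed.
Fact cl_ract1 (u : Cl) : u * cl_scal 1 = u.
Proof. by rewrite cl_scal1 mulr1. Qed.
Fact cl_ractM (u : Cl) a b : u * cl_scal (a * b) = u * cl_scal a * cl_scal b.
Proof. by rewrite cl_scalM mulrA. Qed.

Definition cl_bimodule : bimodule A :=
  Bimodule cl_linl cl_linr cl_rlinl cl_rlinr cl_lact1 cl_lactM cl_ract1 cl_ractM
    (fun a u b => esym (mulrA (cl_scal a) u (cl_scal b))).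

End CliffordAlgebra.

(* A left ideal of the Clifford algebra stable under right multiplication by  *)
(* A, hence an A-bimodule and a left module over the Clifford algebra.        *)
Section LeftIdeal.
Variables (C : numClosedFieldType) (A : algType C) (M : bimodule A).
Variables (sigma : btens M M -> btens M M) (g : btens M M -> A).

Record cl_left_ideal := ClLeftIdeal {
  li_sub :> submodClosed (Cl sigma g);
  li_left : forall u s : Cl sigma g, s \in li_sub -> u * s \in li_sub;
  li_right : forall (s : Cl sigma g) (a : A), s \in li_sub -> s * cl_scal sigma g a \in li_sub }.

Variable I : cl_left_ideal.
Record li_type := LiType { li_val : Cl sigma g; li_valP : li_val \in li_sub I }.
HB.instance Definition _ := [isSub for li_val].
HB.instance Definition _ := [Choice of li_type by <:].
HB.instance Definition _ := [SubChoice_isSubLmodule of li_type by <:].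

Lemma li_val_linear : linear li_val.
Proof. by move=> c x y; exact: (linearP (\val : {linear li_type -> Cl sigma g})). Qed.
Lemma li_val_inj : injective li_val.
Proof. exact: val_inj. Qed.

Definition li_act (u : Cl sigma g) (s : li_type) : li_type :=
  LiType (li_left u (li_valP s)).
Definition li_ract (s : li_type) (a : A) : li_type :=
  LiType (li_right a (li_valP s)).

Fact li_linl s : linear (fun a => li_act (cl_scal sigma g a) s).
Proof.
move=> c a b; apply: li_val_inj.
apply: etrans (esym (li_val_linear _ _ _)); exact: (cl_linl (li_val s) c a b).
Qed.
Fact li_linr a : linear (li_act (cl_scal sigma g a)).
Proof.
move=> c s t; apply: li_val_inj; apply: etrans (esym (li_val_linear _ _ _)).
apply: etrans (cl_linr a c (li_val s) (li_val t)); congr (_ * _); exact: li_val_linear.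
Qed.
Fact li_rlinl a : linear (li_ract ^~ a).
Proof.
move=> c s t; apply: li_val_inj; apply: etrans (esym (li_val_linear _ _ _)).
apply: etrans (cl_rlinl a c (li_val s) (li_val t)); congr (_ * _); exact: li_val_linear.
Qed.
Fact li_rlinr s : linear (li_ract s).
Proof.
move=> c a b; apply: li_val_inj.
apply: etrans (esym (li_val_linear _ _ _)); exact: (cl_rlinr (li_val s) c a b).
Qed.
Fact li_act1 s : li_act (cl_scal sigma g 1) s = s.
Proof. by apply: li_val_inj; exact: cl_lact1. Qed.
Fact li_actM a b s :
  li_act (cl_scal sigma g (a * b)) s = li_act (cl_scal sigma g a) (li_act (cl_scal sigma g b) s).
Proof. by apply: li_val_inj; exact: cl_lactM. Qed.
Fact li_ract1 s : li_ract s 1 = s.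
Proof. by apply: li_val_inj; exact: cl_ract1. Qed.
Fact li_ractM s a b : li_ract s (a * b) = li_ract (li_ract s a) b.
Proof. by apply: li_val_inj; exact: cl_ractM. Qed.
Fact li_lractC a s b :
  li_ract (li_act (cl_scal sigma g a) s) b = li_act (cl_scal sigma g a) (li_ract s b).
Proof. by apply: li_val_inj; rewrite /= mulrA. Qed.

Definition li_bimodule : bimodule A :=
  Bimodule li_linl li_linr li_rlinl li_rlinr li_act1 li_actM li_ract1 li_ractM li_lractC.

End LeftIdeal.

Record hopf_star_algebra (C : numClosedFieldType) := HopfStarAlgebra {
  hopf_alg :> algType C;
  Delta : {linear hopf_alg -> ctens hopf_alg hopf_alg};
  counit : {scalar hopf_alg};
  antipode : {linear hopf_alg -> hopf_alg};
  hstar : hopf_alg -> hopf_alg;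
  Delta_coassoc : forall a : hopf_alg,
    \tsum_(a1 ⊗ a2 <- Delta a) a1 ⊗ Delta a2 =
    \tsum_(a1 ⊗ a2 <- Delta a) \tsum_(b1 ⊗ b2 <- Delta a1) b1 ⊗ b2 ⊗ a2;
  counitl : forall a, \tsum_(a1 ⊗ a2 <- Delta a) counit a1 *: a2 = a;
  counitr : forall a, \tsum_(a1 ⊗ a2 <- Delta a) counit a2 *: a1 = a;
  Delta1 : Delta 1 = 1 ⊗ 1;
  DeltaM : forall a b : hopf_alg, Delta (a * b) =
    \tsum_(a1 ⊗ a2 <- Delta a) \tsum_(b1 ⊗ b2 <- Delta b) (a1 * b1) ⊗ (a2 * b2);
  counit1 : counit 1 = 1;
  counitM : forall a b, counit (a * b) = counit a * counit b;
  antipodel : forall a, \tsum_(a1 ⊗ a2 <- Delta a) antipode a1 * a2 = (counit a)%:A;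
  antipoder : forall a, \tsum_(a1 ⊗ a2 <- Delta a) a1 * antipode a2 = (counit a)%:A;
  hstar_antilinear : antilinear hstar;
  hstarM : forall a b, hstar (a * b) = hstar b * hstar a;
  hstarK : involutive hstar;
  Delta_star : forall a : hopf_alg,
    Delta (hstar a) = \tsum_(a1 ⊗ a2 <- Delta a) hstar a1 ⊗ hstar a2 }.

Section HopfAlgebra.
Variables (C : numClosedFieldType) (A : hopf_star_algebra C).
Implicit Types (a b : A) (P Q : A -> Prop).

Definition subcoalgebra P : Prop :=
  [/\ P 0, forall (c : C) a b, P a -> P b -> P (c *: a + b) &
      forall a, P a -> exists s : seq (A * A),
        (forall p, p \in s -> P p.1 /\ P p.2) /\
        Delta A a = \sum_(p <- s) p.1 ⊗ p.2].

Definition simple_subcoalgebra P : Prop :=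
  [/\ subcoalgebra P, exists2 a, P a & a != 0 &
      forall Q, subcoalgebra Q -> (forall a, Q a -> P a) ->
        (forall a, Q a -> a = 0) \/ (forall a, P a -> Q a)].

Definition cosemisimple : Prop :=
  forall a, exists s : seq A, a = \sum_(x <- s) x /\
    forall x, x \in s -> exists2 P, simple_subcoalgebra P & P x.

Definition haar_functional (h : {scalar A}) : Prop :=
  [/\ h 1 = 1,
      forall a, \tsum_(a1 ⊗ a2 <- Delta A a) h a2 *: a1 = (h a)%:A &
      forall a, \tsum_(a1 ⊗ a2 <- Delta A a) h a1 *: a2 = (h a)%:A].

Definition in_hopf_dual (f : A -> C) : Prop :=
  exists (m : nat) (u v : 'I_m -> {scalar A}),
    forall a b, f (a * b) = \sum_(k < m) u k a * v k b.

Definition dual_S2 (f : A -> C) (a : A) : C := f (antipode A (antipode A a)).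
Definition dual_star (f : A -> C) (a : A) : C := (f (hstar (antipode A a)))^*.

(* The involution beta of A given by the modular automorphism rho.            *)
Definition beta_alg (rho : A -> A) (a : A) : A := hstar (rho a).

Definition left_invariant (V : lmodType C) (delta : V -> ctens A V) (x : V) : Prop :=
  delta x = 1 ⊗ x.

End HopfAlgebra.
Arguments left_invariant {C A V}.

Record lcbimodule (C : numClosedFieldType) (A : hopf_star_algebra C) := LCBimodule {
  lcb_bim :> bimodule A;
  coact : {linear lcb_bim -> ctens A lcb_bim};
  coact_coassoc : forall x : lcb_bim,
    \tsum_(a ⊗ y <- coact x) a ⊗ coact y =
    \tsum_(a ⊗ y <- coact x) \tsum_(a1 ⊗ a2 <- Delta A a) a1 ⊗ a2 ⊗ y;
  coact_counit : forall x : lcb_bim, \tsum_(a ⊗ y <- coact x) counit A a *: y = x;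
  coact_bim : forall (a : A) (x : lcb_bim) (b : A), coact (a ·l x ·r b) =
    \tsum_(a1 ⊗ a2 <- Delta A a) \tsum_(c ⊗ y <- coact x)
      \tsum_(b1 ⊗ b2 <- Delta A b) (a1 * c * b1) ⊗ (a2 ·l y ·r b2) }.

Definition coact2 (C : numClosedFieldType) (A : hopf_star_algebra C)
    (M N : bimodule A) (dM : M -> ctens A M) (dN : N -> ctens A N)
    (t : btens M N) : ctens A (btens M N) :=
  \tsum_(x ⊗ y <- t) \tsum_(a ⊗ x0 <- dM x) \tsum_(b ⊗ y0 <- dN y)
    (a * b) ⊗ (x0 ⊙ y0).

Record star_calculus (C : numClosedFieldType) (A : hopf_star_algebra C) :=
  StarCalculus {
  calc_mod :> lcbimodule A;
  calc_d : {linear A -> calc_mod};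
  calc_star : calc_mod -> calc_mod;
  calc_leibniz : forall a b : A, calc_d (a * b) = calc_d a ·r b + a ·l calc_d b;
  calc_span : forall x : calc_mod, exists s : seq (A * A),
    x = \sum_(p <- s) p.1 ·l calc_d p.2;
  calc_d_cov : forall a : A,
    coact calc_mod (calc_d a) = \tsum_(a1 ⊗ a2 <- Delta A a) a1 ⊗ calc_d a2;
  calc_star_antilinear : antilinear calc_star;
  calc_starK : involutive calc_star;
  calc_star_bim : forall (a : A) (x : calc_mod) (b : A),
    calc_star (a ·l x ·r b) = hstar b ·l calc_star x ·r hstar a;
  calc_star_d : forall a : A, calc_star (calc_d a) = calc_d (hstar a) }.
Arguments calc_d {C A} _.
Arguments calc_star {C A} _.

Section Calculus.
Variables (C : numClosedFieldType) (A : hopf_star_algebra C) (Gam : star_calculus A).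

Definition omega (a : A) : Gam :=
  \tsum_(a1 ⊗ a2 <- Delta A a) antipode A a1 ·l calc_d Gam a2.

Definition R_Gam (a : A) : Prop := omega a = 0 /\ counit A a = 0.

Variable n : nat.
Variables (theta : 'I_n -> Gam) (X : 'I_n -> {scalar A}).

Record dual_bases : Prop := {
  theta_inv : forall i, left_invariant (coact Gam) (theta i);
  theta_span : forall x : Gam, left_invariant (coact Gam) x ->
    exists c : 'I_n -> C, x = \sum_i c i *: theta i;
  theta_free : forall c : 'I_n -> C, \sum_i c i *: theta i = 0 -> forall i, c i = 0;
  X_dual : forall i, in_hopf_dual (X i);
  X_free : forall c : 'I_n -> C,
    (forall a, \sum_i c i * X i a = 0) -> forall i, c i = 0;
  calc_dE : forall a : A,
    calc_d Gam a = \sum_i \tsum_(a1 ⊗ a2 <- Delta A a) (X i a2 *: a1) ·l theta i }.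

(* The quantum tangent space, spanned by the X_i.                             *)
Definition tangent_space (f : A -> C) : Prop :=
  exists c : 'I_n -> C, forall a, f a = \sum_i c i * X i a.

Record S2_invariant (F : 'M[C]_n) (S2 : Gam -> Gam) : Prop := {
  S2_tangent : forall f, tangent_space f <->
    exists2 f', tangent_space f' & f =1 dual_S2 f';
  S2_X : forall i a, dual_S2 (X i) a = \sum_j F i j * X j a;
  S2_linear : linear S2;
  S2_theta : forall i, S2 (theta i) = \sum_j F j i *: theta j;
  S2_lact : forall (a : A) (x : Gam),
    S2 (a ·l x) = antipode A (antipode A a) ·l S2 x }.

Record calc_involution (rho : A -> A) (B : 'M[C]_n) (beta : Gam -> Gam) : Prop := {
  beta_X : forall i a, dual_star (dual_S2 (X i)) a = \sum_j B i j * X j a;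
  beta_antilinear : antilinear beta;
  betaK : involutive beta;
  beta_theta : forall i, beta (theta i) = \sum_j (B j i)^* *: theta j;
  beta_bim : forall (a : A) (x : Gam) (b : A),
    beta (a ·l x ·r b) = beta_alg rho b ·l beta x ·r beta_alg rho a }.

Let G2 : bimodule A := btens Gam Gam.
Let G3 : bimodule A := btens Gam G2.

Definition coactG2 : G2 -> ctens A G2 := coact2 (coact Gam) (coact Gam).

Definition tens_map (f : Gam -> Gam) (t : G2) : G2 :=
  \tsum_(x ⊗ y <- t) f x ⊙ f y.
Definition starG2 (t : G2) : G2 :=
  \tsum_(x ⊗ y <- t) calc_star Gam y ⊙ calc_star Gam x.

Definition leg12 (s : G2 -> G2) (t : G3) : G3 :=
  \tsum_(x ⊗ p <- t) \tsum_(y ⊗ z <- p) \tsum_(x' ⊗ y' <- s (x ⊙ y)) x' ⊙ y' ⊙ z.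
Definition leg23 (s : G2 -> G2) (t : G3) : G3 :=
  \tsum_(x ⊗ p <- t) x ⊙ s p.
Definition contract12 (g : G2 -> A) (t : G3) : Gam :=
  \tsum_(x ⊗ p <- t) \tsum_(y ⊗ z <- p) g (x ⊙ y) ·l z.
Definition contract23 (g : G2 -> A) (t : G3) : Gam :=
  \tsum_(x ⊗ p <- t) x ·r g p.

Record braiding (S2 : Gam -> Gam) (sigma sigmaV : G2 -> G2) : Prop := {
  sigma_linear : linear sigma;
  sigmaK : cancel sigma sigmaV;
  sigmaVK : cancel sigmaV sigma;
  sigma_bim : forall (a : A) (t : G2) (b : A), sigma (a ·l t ·r b) = a ·l sigma t ·r b;
  sigma_cov : forall t, coactG2 (sigma t) = \tsum_(a ⊗ t0 <- coactG2 t) a ⊗ sigma t0;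
  sigma_braid : forall t,
    leg12 sigma (leg23 sigma (leg12 sigma t)) = leg23 sigma (leg12 sigma (leg23 sigma t));
  sigma_omega : forall a, R_Gam a ->
    let t : G2 := \tsum_(a1 ⊗ a2 <- Delta A a) omega a1 ⊙ omega a2 in sigma t = t;
  sigma_S2 : forall t, sigma (tens_map S2 t) = tens_map S2 (sigma t);
  sigma_star : (forall t, starG2 (sigma t) = sigma (starG2 t)) \/
               (forall t, starG2 (sigma t) = sigmaV (starG2 t)) }.

Record sigma_metric (S2 : Gam -> Gam) (sigma sigmaV : G2 -> G2) (g : G2 -> A) : Prop := {
  g_linear : linear g;
  g_bim : forall (a : A) (t : G2) (b : A), g (a ·l t ·r b) = a * g t * b;
  g_cov : forall t, Delta A (g t) = \tsum_(a ⊗ t0 <- coactG2 t) a ⊗ g t0;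
  g_ndegl : forall x : Gam, (forall y : Gam, g (x ⊙ y) = 0) -> x = 0;
  g_ndegr : forall y : Gam, (forall x : Gam, g (x ⊙ y) = 0) -> y = 0;
  g_sigma : forall t, g (sigma t) = g t;
  g_braid : forall t, contract12 g (leg23 sigma (leg12 sigma t)) = contract23 g t;
  g_braidV : forall t, contract12 g (leg23 sigmaV (leg12 sigmaV t)) = contract23 g t;
  g_star : forall x y : Gam, hstar (g (x ⊙ y)) = g (calc_star Gam y ⊙ calc_star Gam x);
  g_S2 : forall x y : Gam,
    left_invariant (coact Gam) x -> left_invariant (coact Gam) y ->
    g (S2 y ⊙ x) = g (x ⊙ y) }.

End Calculus.

Section Clifford.
Variables (C : numClosedFieldType) (A : hopf_star_algebra C) (Gam : star_calculus A).
Variables (sigma : btens Gam Gam -> btens Gam Gam) (g : btens Gam Gam -> A).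
Let cl : bimodule A := cl_bimodule sigma g.

(* The left coaction making Cl a left-covariant algebra; it is determined by  *)
(* its values on the generators.                                              *)
Record cl_coaction (delta : {linear cl -> ctens A cl}) : Prop := {
  cl_coact_coassoc : forall u : cl, \tsum_(a ⊗ v <- delta u) a ⊗ delta v =
    \tsum_(a ⊗ v <- delta u) \tsum_(a1 ⊗ a2 <- Delta A a) a1 ⊗ a2 ⊗ v;
  cl_coact_counit : forall u : cl, \tsum_(a ⊗ v <- delta u) counit A a *: v = u;
  cl_coactM : forall u v : Cl sigma g, delta (u * v) =
    \tsum_(a ⊗ u0 <- delta u) \tsum_(b ⊗ v0 <- delta v)
      (a * b) ⊗ ((u0 : Cl sigma g) * v0 : cl);
  cl_coact_scal : forall a : A, delta (cl_scal sigma g a) =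
    \tsum_(a1 ⊗ a2 <- Delta A a) a1 ⊗ (cl_scal sigma g a2 : cl);
  cl_coact_vec : forall x : Gam, delta (cl_vec sigma g x) =
    \tsum_(a ⊗ x0 <- coact Gam x) a ⊗ (cl_vec sigma g x0 : cl) }.

(* The involution of Cl extending the involutions of A and Gam.               *)
Record cl_involution (rho : A -> A) (beta : Gam -> Gam)
    (betaCl : Cl sigma g -> Cl sigma g) : Prop := {
  betaCl_antilinear : antilinear betaCl;
  betaClM : forall u v, betaCl (u * v) = betaCl v * betaCl u;
  betaClK : involutive betaCl;
  betaCl_scal : forall a : A, betaCl (cl_scal sigma g a) = cl_scal sigma g (beta_alg rho a);
  betaCl_vec : forall x : Gam, betaCl (cl_vec sigma g x) = cl_vec sigma g (beta x) }.

Variable S : cl_left_ideal sigma g.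
Let SB : bimodule A := li_bimodule S.

(* The left ideal S is left-covariant: delta restricts to a coaction on S.    *)
(* Only the last field is a condition, namely delta(S) ⊂ A ⊗ S; the others    *)
(* are inherited from delta since A ⊗ S embeds in A ⊗ Cl.                     *)
Record li_coaction (delta : {linear cl -> ctens A cl})
    (deltaS : {linear SB -> ctens A SB}) : Prop := {
  li_coact_coassoc : forall phi : SB, \tsum_(a ⊗ s <- deltaS phi) a ⊗ deltaS s =
    \tsum_(a ⊗ s <- deltaS phi) \tsum_(a1 ⊗ a2 <- Delta A a) a1 ⊗ a2 ⊗ s;
  li_coact_counit : forall phi : SB,
    \tsum_(a ⊗ s <- deltaS phi) counit A a *: s = phi;
  li_coactM : forall (u : Cl sigma g) (phi : SB), deltaS (li_act u phi) =
    \tsum_(a ⊗ u0 <- delta u) \tsum_(b ⊗ s <- deltaS phi)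
      (a * b) ⊗ (li_act u0 s : SB);
  li_coact_val : forall phi : SB,
    \tsum_(a ⊗ s <- deltaS phi) a ⊗ (li_val s : cl) = delta (li_val phi) }.

Record spinor_metric (h : A -> C) (deltaS : {linear SB -> ctens A SB})
    (form0 : SB -> SB -> A) : Prop := {
  form0Dl : forall phi phi' psi, form0 (phi + phi') psi = form0 phi psi + form0 phi' psi;
  form0Dr : forall phi psi psi', form0 phi (psi + psi') = form0 phi psi + form0 phi psi';
  form0M : forall (a b : A) phi psi,
    form0 (a ·l phi) (b ·l psi) = a * form0 phi psi * hstar b;
  form0_cov : forall phi psi, Delta A (form0 phi psi) =
    \tsum_(a ⊗ phi0 <- deltaS phi) \tsum_(b ⊗ psi0 <- deltaS psi)
      (a * hstar b) ⊗ form0 phi0 psi0;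
  form_herm : forall phi psi, h (form0 phi psi) = (h (form0 psi phi))^*;
  form_ndeg : forall phi, (forall psi, h (form0 phi psi) = 0) -> phi = 0 }.

Definition left_connection (M : bimodule A) (nabla : M -> btens Gam M) : Prop :=
  linear nabla /\
  forall (a : A) (x : M), nabla (a ·l x) = calc_d Gam a ⊙ x + a ·l nabla x.

Record bimodule_connection (M : bimodule A) (nabla : M -> btens Gam M)
    (st : btens M Gam -> btens Gam M) : Prop := {
  bc_left : left_connection nabla;
  bc_linear : linear st;
  bc_bim : forall (a : A) t (b : A), st (a ·l t ·r b) = a ·l st t ·r b;
  bc_right : forall (x : M) (a : A),
    st (x ⊙ calc_d Gam a) = nabla (x ·r a) - nabla x ·r a }.

Record linear_left_connection (nabla : cl -> btens Gam cl)
    (st : btens cl Gam -> btens Gam cl) : Prop := {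
  llc_bimodule : bimodule_connection nabla st;
  llc_prod : forall u v : Cl sigma g, nabla (u * v) =
    \tsum_(x ⊗ u0 <- nabla u) x ⊙ ((u0 : Cl sigma g) * v : cl) +
    \tsum_(x ⊗ v0 <- nabla v) \tsum_(y ⊗ u0 <- st ((u : cl) ⊙ x))
      y ⊙ ((u0 : Cl sigma g) * v0 : cl) }.

(* [sc_cov] says that the connection is left-covariant.                       *)
Record spinor_connection (deltaS : SB -> ctens A SB)
    (nabla : cl -> btens Gam cl) (st : btens cl Gam -> btens Gam cl)
    (nablaS : SB -> btens Gam SB) (stS : btens SB Gam -> btens Gam SB) : Prop := {
  sc_bimodule : bimodule_connection nablaS stS;
  sc_compat : forall (u : Cl sigma g) (phi : SB), nablaS (li_act u phi) =
    \tsum_(x ⊗ u0 <- nabla u) x ⊙ (li_act u0 phi : SB) +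
    \tsum_(x ⊗ phi0 <- nablaS phi) \tsum_(y ⊗ u0 <- st ((u : cl) ⊙ x))
      y ⊙ (li_act u0 phi0 : SB);
  sc_cov : forall phi, coact2 (coact Gam) deltaS (nablaS phi) =
    \tsum_(a ⊗ phi0 <- deltaS phi) a ⊗ nablaS phi0 }.

Definition dirac (nablaS : SB -> btens Gam SB) (phi : SB) : SB :=
  \tsum_(x ⊗ s <- nablaS phi) (li_act (cl_vec sigma g x) s : SB).

End Clifford.

(* Main.v *)
Require Import Defs.
From mathcomp Require Import all_boot all_order all_algebra.
From mathcomp Require Import boolp reals complex.
Import GRing.Theory Num.Theory.
Local Open Scope ring_scope.
Set Implicit Arguments.
Unset Strict Implicit.
Unset Printing Implicit Defensive.

(** The form <phi, psi> = h(<phi, psi>_0) satisfies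
    <a phi, psi> = <phi, beta(a) psi> for a in A, because beta(a)^* = rho(a) and
    rho is the modular automorphism of h.  The connection gives
    D(a phi) = da.phi + a D(phi).  The two facts combine through the identity

       beta(da) = - d(beta(a)),                                  [beta_d]

    which says that the form-adjoint that (b) prescribes for da = [D, a] is the
    commutator [beta(a), D] = - d(beta(a)).

    If D is symmetric, then da.phi = D(a phi) - a D(phi), so symmetry and the
    A-adjunction give <da.phi, psi> = - <phi, d(beta(a)).psi>, that is,
    <da.phi, psi> = <phi, beta(da).psi>.  Condition (b) is multiplicative and
    additive in u, and A together with dA generates the Clifford algebra.

    Conversely, under (b), symmetry on (a phi, psi) follows from symmetry on
    (phi, beta(a) psi).  As a left-covariant module is generated over A by its
    invariant elements [left_inv_decomposition], phi may be taken invariant.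
    For such phi, invariance of h gives <phi, psi> = <phi, P psi>, where
    P psi = h(psi_(-1)) psi_(0) is invariant [form_haar_proj].  D is covariant,
    so it preserves invariant elements and commutes with P; hence
    <D phi, psi> = <D phi, P psi> and <phi, D psi> = <phi, D P psi>, which agree
    by (a).

    For beta_d, let w(a) = sum_i X_i(a) theta_i, so that da = a_1 w(a_2), and write
    star for the involution of A.  The definition of beta on the theta_i gives
    beta(da) = w(S^2(star(S(a_2)))) star(rho(a_1)).  The modular automorphism
    satisfies rho(a)_1 (x) S^2(rho(a)_2) = rho(a_1) (x) a_2
    [modular_coproduct]; with S(star(S(x))) = star(x) [antipode_star] this turns
    the right side into w(T(q_2)) q_1, where q = beta(a) and T = star S star is
    the inverse of the antipode.  That expression is -dq by the Leibniz rule
    [d_skew_antipode].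

    The Hopf-algebraic identities are tested against h: the relation
    h(b_1 x) b_2 = h(b x_1) S(x_2) [haar_shift] exchanges the antipode for a
    shift of coproducts, and h is non-degenerate [haar_nondegenerate], so that
    two tensors with the same slices under all h(b _) agree
    [tens_separated]. *)

(** * Sweedler sums *)

Section Additive.
Variables (C : numClosedFieldType) (U V : lmodType C).
Lemma linear_add (f : U -> V) : linear f -> {morph f : x y / x + y}.
Proof. by move=> Hf x y; have := Hf 1 x y; rewrite !scale1r. Qed.
Lemma antilinear_add (f : U -> V) : antilinear f -> {morph f : x y / x + y}.
Proof. by move=> Hf x y; have := Hf 1 x y; rewrite rmorph1 !scale1r. Qed.
End Additive.

Lemma morph_add0 (U V : zmodType) (f : U -> V) : {morph f : x y / x + y} -> f 0 = 0.
Proof. by move=> fD; apply: (addrI (f 0)); rewrite -fD !addr0. Qed.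

Section Scaling.
Variables (C : numClosedFieldType) (U V : lmodType C).
Lemma linear_scale (f : U -> V) : linear f -> forall c x, f (c *: x) = c *: f x.
Proof.
move=> Hf c x; have := Hf c x 0.
by rewrite !addr0 (morph_add0 (linear_add Hf)) addr0.
Qed.
Lemma antilinear_scale (f : U -> V) : antilinear f -> forall c x, f (c *: x) = c^* *: f x.
Proof.
move=> Hf c x; have := Hf c x 0.
by rewrite !addr0 (morph_add0 (antilinear_add Hf)) addr0.
Qed.
End Scaling.

Section Texp.
Variables (C : numClosedFieldType) (M N : lmodType C) (K : Type).
Variables (ra : M -> K -> M) (la : K -> N -> N).
Implicit Type t : tens ra la.

Lemma eq_texp (V : zmodType) t (F G : M -> N -> V) :
  (forall x y, F x y = G x y) -> texp t F = texp t G.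
Proof. by move=> E; apply: eq_bigr => p _. Qed.

Lemma texp_map (V W : zmodType) (f : V -> W) t (F : M -> N -> V) :
  {morph f : x y / x + y} -> f (texp t F) = texp t (fun x y => f (F x y)).
Proof. by move=> fD; rewrite /texp (big_morph f fD (morph_add0 fD)). Qed.

Lemma texpD (V : zmodType) t (F G : M -> N -> V) :
  texp t (fun x y => F x y + G x y) = texp t F + texp t G.
Proof. exact: big_split. Qed.

Lemma texpB (V : zmodType) t (F G : M -> N -> V) :
  texp t (fun x y => F x y - G x y) = texp t F - texp t G.
Proof. by rewrite texpD [X in _ + X]sumrN. Qed.

Lemma texp_sum (V : zmodType) (I : finType) t (F : I -> M -> N -> V) :
  \sum_i texp t (F i) = texp t (fun x y => \sum_i F i x y).
Proof. exact: exchange_big. Qed.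

End Texp.

Lemma texp_exchange (C : numClosedFieldType) (M N M' N' : lmodType C) (K K' : Type)
    (ra : M -> K -> M) (la : K -> N -> N) (ra' : M' -> K' -> M') (la' : K' -> N' -> N')
    (V : zmodType) (t : tens ra la) (t' : tens ra' la') (F : M -> N -> M' -> N' -> V) :
  \tsum_(x ⊗ y <- t) \tsum_(u ⊗ v <- t') F x y u v =
  \tsum_(u ⊗ v <- t') \tsum_(x ⊗ y <- t) F x y u v.
Proof. exact: exchange_big. Qed.

Section ComplexTensor.
Variable C : numClosedFieldType.
Implicit Types M N V W : lmodType C.

(** The part of [balanced] that remains over [C], where linearity in both
    arguments forces the balancing condition. *)
Definition bilinear_map M N V (F : M -> N -> V) : Prop :=
  (forall y, linear (F^~ y)) /\ (forall x, linear (F x)).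
Definition bi_antilinear M N V (F : M -> N -> V) : Prop :=
  (forall y, antilinear (F^~ y)) /\ (forall x, antilinear (F x)).

Lemma bilinear_balanced M N V (F : M -> N -> V) : bilinear_map F ->
  balanced (fun (x : M) (c : C) => c *: x) (fun c (y : N) => c *: y) (fun p => F p.1 p.2).
Proof.
by case=> H1 H2; split=> // x c y /=; rewrite (linear_scale (H1 y)) (linear_scale (H2 x)).
Qed.

Lemma bi_anti_balanced M N V (F : M -> N -> V) : bi_antilinear F ->
  antibalanced (fun (x : M) (c : C) => c *: x) (fun c (y : N) => c *: y) F.
Proof.
by case=> H1 H2; split=> // x c y /=; rewrite (antilinear_scale (H1 y)) (antilinear_scale (H2 x)).
Qed.

Lemma ctexp_linear M N V (F : M -> N -> V) : bilinear_map F ->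
  linear (fun t : ctens M N => texp t F).
Proof. by move/bilinear_balanced/texp_linear. Qed.

Lemma ctexp_pure M N V (F : M -> N -> V) x y : bilinear_map F -> texp (x ⊗ y) F = F x y.
Proof. by move/bilinear_balanced/(texp_pure x y). Qed.

Lemma ctpure_linl M N (y : N) : linear (fun x : M => x ⊗ y).
Proof. exact: tpure_linl. Qed.
Lemma ctpure_linr M N (x : M) : linear (fun y : N => x ⊗ y).
Proof. exact: tpure_linr. Qed.

Lemma ctensE M N (t : ctens M N) : t = \tsum_(x ⊗ y <- t) x ⊗ y.
Proof. exact: tdecompE. Qed.

Section Nested.
Variables (M N U V : lmodType C) (L K : Type).
Variables (rM : M -> L -> M) (lN : L -> N -> N) (ra : U -> K -> U) (la : K -> V -> V).
Variable t : tens ra la.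

Lemma texp_texp_balanced (W : lmodType C) (G : U -> V -> tens rM lN) (F : M -> N -> W) :
  balanced rM lN (fun p => F p.1 p.2) ->
  texp (texp t G) F = \tsum_(u ⊗ v <- t) texp (G u v) F.
Proof.
move=> HF; apply: (texp_map (f := fun s : tens rM lN => texp s F)).
exact: linear_add (texp_linear HF).
Qed.
End Nested.

Section NestedComplex.
Variables (M N U V W : lmodType C) (K : Type).
Variables (ra : U -> K -> U) (la : K -> V -> V) (t : tens ra la).

Lemma texp_texp (G : U -> V -> ctens M N) (F : M -> N -> W) : bilinear_map F ->
  texp (texp t G : ctens M N) F = \tsum_(u ⊗ v <- t) texp (G u v) F.
Proof. by move/bilinear_balanced/texp_texp_balanced. Qed.

Lemma texp_texp_pure (a : U -> V -> M) (b : U -> V -> N) (F : M -> N -> W) :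
  bilinear_map F ->
  texp (\tsum_(u ⊗ v <- t) a u v ⊗ b u v : ctens M N) F =
  \tsum_(u ⊗ v <- t) F (a u v) (b u v).
Proof.
by move=> HF; rewrite texp_texp //; apply: eq_texp => u v; rewrite ctexp_pure.
Qed.

Lemma texp_texp_anti (a : U -> V -> M) (b : U -> V -> N) (F : M -> N -> W) :
  bi_antilinear F ->
  texp (\tsum_(u ⊗ v <- t) a u v ⊗ b u v : ctens M N) F =
  \tsum_(u ⊗ v <- t) F (a u v) (b u v).
Proof.
move/bi_anti_balanced=> HF.
rewrite (texp_map (f := fun s : ctens M N => texp s F)).
  by apply: eq_texp => u v; apply: texp_pure_anti.
exact: antilinear_add (texp_antilinear HF).
Qed.
End NestedComplex.

Lemma texp_bilinear M N V W (F : M -> N -> V -> W) (t : ctens M N) :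
  (forall x y, linear (F x y)) -> linear (fun v => texp t (fun x y => F x y v)).
Proof. by move=> H c u v; apply: texp_lin => x y; apply: H. Qed.

Lemma scale_bilinear M N V (k : M -> C) (f : N -> V) :
  scalar k -> linear f -> bilinear_map (fun y z => k y *: f z).
Proof.
move=> kl fl; split=> [y c u v|y c u v]; first by rewrite kl scalerDl scalerA.
by rewrite fl scalerDr !scalerA mulrC.
Qed.

(** Elimination on the length of a presentation of [t]: if some [f i] is non-zero
    on the first left factor [x0], the vanishing of the [i]-th slice expresses
    [y0] through the other right factors, and the first term can be absorbed
    into the others; if no [f i] is, the first term can be kept as it is. *)
Lemma tens_kernel (I : Type) (U V : lmodType C) (f : I -> U -> C) (t : ctens U V) :
  (forall i, scalar (f i)) ->
  (forall i, \tsum_(x ⊗ y <- t) f i x *: y = 0) ->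
  exists2 s : seq (U * V), (forall p, p \in s -> forall i, f i p.1 = 0) &
    t = \sum_(p <- s) p.1 ⊗ p.2.
Proof.
move=> fl; rewrite [in X in _ -> X](ctensE t) /texp.
elim: {t}(size _) {-2}(tdecomp t) (leqnn (size (tdecomp t))) => [|m IH] s sz Hs.
  by case: s sz Hs => // _ _; exists [::] => //; rewrite !big_nil.
case: s sz Hs => [|[x0 y0] s] sz Hs; first by exists [::] => //; rewrite !big_nil.
have [[i ni]|/forallNP all0] := pselect (exists i, f i x0 <> 0); last first.
  have f0 i : f i x0 = 0 by apply: contrapT; exact: all0.
  have [i|s' ker' E] := IH s sz.
    by have := Hs i; rewrite big_cons /= f0 scale0r add0r.
  exists ((x0, y0) :: s') => [p|]; last by rewrite !big_cons E.
  by rewrite inE => /predU1P[-> //|]; apply: ker'.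
(* The term [x0 ⊗ y0] is redistributed over [s]. *)
set e := (f i x0)^-1.
pose s1 := [seq (- (e * f i p.1) *: x0 + p.1, p.2) | p <- s].
have y0E : y0 = - e *: \sum_(p <- s) f i p.1 *: p.2.
  have := Hs i; rewrite big_cons /= => /(congr1 ( *:%R e)).
  rewrite scalerDr scalerA mulVf ?scale1r ?scaler0; last exact/eqP.
  by move/eqP; rewrite addr_eq0 scaleNr => /eqP.
have [|j|s' ker' E] := IH s1; first by rewrite size_map.
  rewrite big_map -[RHS](Hs j) big_cons /= y0E !scalerA scaler_sumr -big_split.
  apply: eq_bigr => p _ /=.
  by rewrite fl scalerDl scalerA mulrN !mulNr [_ * e]mulrC mulrAC.
exists s' => //; rewrite -E big_map big_cons /= y0E.
have rD := linear_add (ctpure_linr (N := V) x0).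
rewrite [X in X + _](linear_scale (ctpure_linr x0)).
rewrite [X in _ *: X + _](big_morph (fun y => x0 ⊗ y) rD (morph_add0 rD)).
rewrite scaler_sumr -big_split; apply: eq_bigr => p _ /=.
rewrite [RHS]ctpure_linl; congr (_ + _).
by rewrite (linear_scale (ctpure_linr x0)) scalerA mulNr.
Qed.

Lemma ctexp_sum_pure M N V (s : seq (M * N)) (F : M -> N -> V) : bilinear_map F ->
  texp (\sum_(p <- s) p.1 ⊗ p.2) F = \sum_(p <- s) F p.1 p.2.
Proof.
move=> HF; have fD := linear_add (ctexp_linear HF).
by rewrite (big_morph _ fD (morph_add0 fD)); apply: eq_bigr => p _; rewrite ctexp_pure.
Qed.

(** By [tens_kernel] a tensor with no non-zero slice is zero; so an identity in a
    tensor product may be tested on one leg. *)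
Lemma tens_separated (I : Type) (U V : lmodType C) (f : I -> U -> C) (t u : ctens U V) :
  (forall i, scalar (f i)) -> (forall x, (forall i, f i x = 0) -> x = 0) ->
  (forall i, \tsum_(x ⊗ y <- t) f i x *: y = \tsum_(x ⊗ y <- u) f i x *: y) -> t = u.
Proof.
move=> fl sep E; apply/eqP; rewrite -subr_eq0 -[u]scale1r -scaleNr addrC; apply/eqP.
have bil i := scale_bilinear (fl i) (f := id) (fun c (y y' : V) => erefl (c *: y + y')).
have [i|s ker ->] := tens_kernel (t := -1 *: u + t) fl.
  by rewrite ctexp_linear // E scaleN1r addNr.
rewrite big_seq big1 // => p /ker/sep ->.
exact: morph_add0 (linear_add (ctpure_linl p.2)).
Qed.

End ComplexTensor.

(** * Coassociativity and the involution *)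

Section Coassociativity.
Variables (C : numClosedFieldType) (A : hopf_star_algebra C).

Definition trilinear_map (U V W X : lmodType C) (F : U -> V -> W -> X) : Prop :=
  (forall v w, linear (fun u => F u v w)) /\ (forall u, bilinear_map (F u)).

Lemma comodule_coassoc (V W : lmodType C) (delta : {linear V -> ctens A V})
    (F : A -> A -> V -> W) (x : V) :
  \tsum_(a ⊗ v <- delta x) a ⊗ delta v =
    \tsum_(a ⊗ v <- delta x) \tsum_(a1 ⊗ a2 <- Delta A a) a1 ⊗ a2 ⊗ v ->
  trilinear_map F ->
  \tsum_(a ⊗ v <- delta x) \tsum_(b ⊗ w <- delta v) F a b w =
  \tsum_(a ⊗ v <- delta x) \tsum_(a1 ⊗ a2 <- Delta A a) F a1 a2 v.
Proof.
move=> E [F1 F2].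
have bF : bilinear_map (fun a (s : ctens A V) => texp s (F a)).
  split=> [s|a]; first by apply: texp_bilinear.
  exact: ctexp_linear.
have := congr1 (fun t : ctens A (ctens A V) => texp t (fun a s => texp s (F a))) E.
rewrite texp_texp_pure // texp_texp // => ->.
apply: eq_texp => a v; rewrite texp_texp //; apply: eq_texp => a1 a2.
by rewrite !ctexp_pure.
Qed.

Lemma Delta_coassoc3 (W : lmodType C) (F : A -> A -> A -> W) (a : A) :
  trilinear_map F ->
  \tsum_(a1 ⊗ a2 <- Delta A a) \tsum_(b1 ⊗ b2 <- Delta A a2) F a1 b1 b2 =
  \tsum_(a1 ⊗ a2 <- Delta A a) \tsum_(b1 ⊗ b2 <- Delta A a1) F b1 b2 a2.
Proof. by apply: comodule_coassoc; apply: Delta_coassoc. Qed.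

End Coassociativity.

Section Star.
Variables (C : numClosedFieldType) (A : hopf_star_algebra C).

Lemma hstar1 : hstar 1 = 1 :> A.
Proof. by have := hstarM (hstar (1 : A)) 1; rewrite mulr1 hstarK mulr1. Qed.

Lemma hstarD : {morph @hstar C A : a b / a + b}.
Proof. exact: antilinear_add (@hstar_antilinear C A). Qed.

Lemma hstarZ c (a : A) : hstar (c *: a) = c^* *: hstar a.
Proof. exact: antilinear_scale (@hstar_antilinear C A) _ _. Qed.

Lemma antipode_bilinear : bilinear_map (fun y z : A => y * antipode A z).
Proof.
split=> [y c u v|y c u v]; first by rewrite mulrDl scalerAl.
by rewrite linearP mulrDr scalerAr.
Qed.

End Star.

(** * The Haar functional *)

Section Haar.
Variables (C : numClosedFieldType) (A : hopf_star_algebra C).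
Variables (h : {scalar A}) (h_haar : haar_functional h).
Local Notation S := (antipode A).
Local Notation Δ := (Delta A).

(** Both sides are [h (b1 * x1) *: (b2 * x2 * S x3)]: the antipode axiom collapses
    [x2 * S x3] and gives the left side, invariance of [h] on the product
    [b * x1] gives the right one. *)
Lemma haar_shift b x :
  \tsum_(b1 ⊗ b2 <- Δ b) h (b1 * x) *: b2 = \tsum_(x1 ⊗ x2 <- Δ x) h (b * x1) *: S x2.
Proof.
have [_ _ hr] := h_haar.
have bil : bilinear_map (fun y z : A => h y *: z).
  split=> [y c u v|y c u v]; first by rewrite linearP scalerDl scalerA.
  by rewrite scalerDr !scalerA mulrC.
pose F y z w := \tsum_(b1 ⊗ b2 <- Δ b) h (b1 * y) *: (b2 * z * S w).
have E x1 x2 : h (b * x1) *: S x2 = \tsum_(y ⊗ z <- Δ x1) F y z x2.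
  rewrite -mulr_algl -hr DeltaM texp_texp // /F texp_exchange.
  rewrite (texp_map (f := fun u => u * S x2)); last by move=> u v; rewrite mulrDl.
  apply: eq_texp => b1 b2; rewrite texp_texp_pure //.
  rewrite (texp_map (f := fun u => u * S x2)); last by move=> u v; rewrite mulrDl.
  by apply: eq_texp => y z; rewrite -scalerAl.
transitivity (\tsum_(x1 ⊗ x2 <- Δ x) \tsum_(y ⊗ z <- Δ x1) F y z x2); last first.
  by apply: eq_texp => x1 x2; rewrite E.
rewrite -Delta_coassoc3; last first.
  split=> [v w|u]; first apply: texp_bilinear => b1 b2 c u u'.
    by rewrite mulrDr -scalerAr linearP scalerDl scalerA.
  split=> [v|v] c w w'; apply: texp_lin => b1 b2.
    by rewrite mulrDr mulrDl -scalerAr -scalerAl scalerDr !scalerA mulrC.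
  by rewrite linearP mulrDr -scalerAr scalerDr !scalerA mulrC.
apply: esym; rewrite /F; under eq_texp => x1 x2 do rewrite texp_exchange.
rewrite texp_exchange; apply: eq_texp => b1 b2.
rewrite -[in RHS](counitr x) (texp_map (f := fun u => h (b1 * u) *: b2)); last first.
  by move=> u v; rewrite mulrDr linearD scalerDl.
apply: eq_texp => x1 x2.
rewrite -scalerAr linearZ /= mulrC -scalerA; under eq_texp => y z do rewrite -mulrA.
rewrite -(texp_map (f := fun u : A => h (b1 * x1) *: (b2 * u))).
  by rewrite antipoder mulr_algr.
by move=> u v; rewrite mulrDr scalerDr.
Qed.

Lemma haar_mull a : scalar (fun x => h (x * a)).
Proof. by move=> c u v; rewrite mulrDl -scalerAl linearP. Qed.
Lemma haar_mulr a : scalar (fun x => h (a * x)).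
Proof. by move=> c u v; rewrite mulrDr -scalerAr linearP. Qed.

(** By [haar_shift], the coproduct of an element [y] of the radical has its left
    legs in the radical.  Hence [h] vanishes on the sum of the [y1 * S y2], which
    is [counit y]: the counit vanishes on the radical, and the counit axiom
    makes [x] zero. *)
Lemma haar_nondegenerate x : (forall b, h (x * b) = 0) -> x = 0.
Proof.
have [h1 _ _] := h_haar.
have ker y : (forall b, h (y * b) = 0) -> exists2 s : seq (A * A),
    (forall p, p \in s -> forall b, h (p.1 * b) = 0) & Δ y = \sum_(p <- s) p.1 ⊗ p.2.
  move=> y0; apply: (tens_kernel (f := fun b u => h (u * b))) => b; first exact: haar_mull.
  by rewrite haar_shift /texp big1 // => p _; rewrite y0 scale0r.
have eps0 y : (forall b, h (y * b) = 0) -> counit A y = 0.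
  move=> y0; have [s ker_s E] := ker y y0.
  have := congr1 h (antipoder y); rewrite linearZ /= h1 mulr1 => <-.
  rewrite E (ctexp_sum_pure _ (antipode_bilinear A)) linear_sum big_seq big1 // => p.
  by move/ker_s->.
move=> x0; have [s ker_s E] := ker x x0.
rewrite -(counitl x) E ctexp_sum_pure.
  by rewrite big_seq big1 // => p /ker_s/eps0->; rewrite scale0r.
exact: (scale_bilinear (f := id)) (linearP _) _.
Qed.

(** The conjugate functional [k] is again invariant, and two normalized
    invariant functionals agree: the sum of the [k a1 * h a2] equals both [k a]
    and [h a]. *)
Lemma haar_star a : h (hstar a) = (h a)^*.
Proof.
have [h1 hl hr] := h_haar.
pose k x := (h (hstar x))^*.
have kl : scalar k.
  by move=> c x y; rewrite /k hstarD hstarZ linearP rmorphD rmorphM /= conjCK.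
have kr : \tsum_(a1 ⊗ a2 <- Δ a) k a1 *: a2 = (k a)%:A.
  have := congr1 (@hstar C A) (hr (hstar a)).
  rewrite hstarZ hstar1 Delta_star texp_texp_pure; last first.
    exact: (scale_bilinear (f := id)) (linearP _) _.
  rewrite (texp_map (f := @hstar C A)); last exact: hstarD.
  by under eq_texp => a1 a2 do rewrite hstarZ hstarK.
have <- : k a = h a; last by rewrite /k conjCK.
have kD : {morph k : x y / x + y} by move=> x y; have := kl 1 x y; rewrite scale1r mul1r.
have kZ c x : k (c *: x) = c * k x by have := kl c x 0; rewrite addr0 (morph_add0 kD) addr0.
have := congr1 h kr; rewrite linearZ /= h1 mulr1 => <-.
have k1 : k 1 = 1 by rewrite /k hstar1 h1 conjC1.
have := congr1 k (hl a); rewrite kZ k1 mulr1 => <-.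
rewrite (texp_map _ _ kD) (texp_map (f := h)); last exact: linearD.
by apply: eq_texp => a1 a2; rewrite linearZ kZ mulrC.
Qed.

(** Conjugating [haar_shift] gives [h (b * a1) *: a2 = h (b1 * a) *: T b2], and
    [haar_shift] itself gives [h (b * a1) *: S a2 = h (b1 * a) *: b2].  So [b1 ⊗ S (T b2)]
    and [b1 ⊗ b2] agree when tested against [h (_ * a)]. *)
Lemma antipode_star x : S (hstar (S x)) = hstar x.
Proof.
pose T b := hstar (S (hstar b)).
suff ST b : S (T b) = b by move: (ST (hstar x)); rewrite /T hstarK.
have shiftT a : \tsum_(b1 ⊗ b2 <- Δ b) h (b1 * a) *: T b2 =
                \tsum_(a1 ⊗ a2 <- Δ a) h (b * a1) *: a2.
  have := congr1 (@hstar C A) (haar_shift (hstar a) (hstar b)).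
  rewrite !Delta_star !texp_texp_pure.
  - rewrite !(texp_map (f := @hstar C A)) //; try exact: hstarD.
    under eq_texp => a1 a2 do rewrite hstarZ hstarK -hstarM haar_star conjCK.
    by under [in RHS]eq_texp => b1 b2 do rewrite hstarZ -hstarM haar_star conjCK.
  - exact: scale_bilinear (haar_mulr _) (linearP _).
  - exact: (scale_bilinear (f := id)) (haar_mull _) _.
have TD : {morph T : u v / u + v} by move=> u v; rewrite /T hstarD linearD hstarD.
have Tl : linear T.
  by move=> c u v; rewrite TD; congr (_ + _); rewrite /T hstarZ linearZ /= hstarZ conjCK.
have STl : linear (fun z => S (T z)) by move=> c u v; rewrite Tl linearP.
have : \tsum_(b1 ⊗ b2 <- Δ b) b1 ⊗ S (T b2) = Δ b :> ctens A A.
  apply: (tens_separated (f := fun a u => h (u * a))) => [a|y|a].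
  - exact: haar_mull.
  - exact: haar_nondegenerate.
  - rewrite texp_texp_pure; last exact: (scale_bilinear (f := id)) (haar_mull _) _.
    rewrite haar_shift; under eq_texp => b1 b2 do rewrite -linearZ.
    rewrite -(texp_map (f := S)); last exact: linearD.
    rewrite shiftT (texp_map (f := S)); last exact: linearD.
    by under eq_texp => b1 b2 do rewrite linearZ.
move/(congr1 (fun t : ctens A A => \tsum_(y ⊗ z <- t) counit A y *: z)).
have bil : bilinear_map (fun y z : A => counit A y *: z).
  exact: (scale_bilinear (f := id)) (linearP _) _.
rewrite texp_texp_pure // counitl.
under eq_texp => b1 b2 do rewrite -(linear_scale STl).
rewrite -(texp_map (f := fun z => S (T z))); last exact: linear_add STl.
by rewrite counitl.
Qed.

Lemma haar_nondegenerate_l x : (forall b, h (b * x) = 0) -> x = 0.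
Proof.
move=> x0; rewrite -[x]hstarK (haar_nondegenerate (x := hstar x)) => [|b].
  exact: morph_add0 (@hstarD _ A).
by rewrite -[b]hstarK -hstarM haar_star x0 conjC0.
Qed.

(** Tested against [h (b * _)], where [p = rho a]:
    [h (b * p1) *: S p2 = h (b1 * p) *: b2 = h (a * b1) *: b2] by [haar_shift] and the
    modular property, and [h (a * b1) *: S b2 = h (a1 * b) *: a2 = h (b * rho a1) *: a2]
    in the same way. *)
Lemma modular_coproduct (rho : A -> A) : linear rho ->
  (forall a b, h (a * b) = h (b * rho a)) -> forall a,
  \tsum_(p1 ⊗ p2 <- Δ (rho a)) p1 ⊗ S (S p2) = \tsum_(a1 ⊗ a2 <- Δ a) rho a1 ⊗ a2
  :> ctens A A.
Proof.
move=> rhol h_rho a.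
apply: (tens_separated (f := fun b u => h (b * u))) => [b|x|b].
- exact: haar_mulr.
- exact: haar_nondegenerate_l.
have bil := scale_bilinear (haar_mulr b) (f := id) (fun _ _ _ => erefl).
rewrite !texp_texp_pure //.
under eq_texp => p1 p2 do rewrite -linearZ.
rewrite -(texp_map (f := S)) -?haar_shift; last exact: linearD.
rewrite (texp_map (f := S)); last exact: linearD.
under eq_texp => b1 b2 do rewrite linearZ -h_rho.
rewrite -haar_shift; apply: eq_texp => a1 a2.
by rewrite h_rho.
Qed.

End Haar.

(** * The skew antipode *)

Section Counit.
Variables (C : numClosedFieldType) (A : hopf_star_algebra C).
Local Notation S := (antipode A).
Local Notation Δ := (Delta A).
Local Notation eps := (counit A).
Local Notation T := (fun a : A => hstar (S (hstar a))).

Lemma skew_antipode_linear : linear T.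
Proof. by move=> c x y; rewrite hstarD hstarZ linearP hstarD hstarZ conjCK. Qed.

(** The conjugate [e] of the counit is a right counit; hence the sum of the
    [eps a1 * e a2] equals both [e a] and [eps a]. *)
Lemma counit_star a : eps (hstar a) = (eps a)^*.
Proof.
pose e x := (eps (hstar x))^*.
have eD : {morph e : x y / x + y} by move=> x y; rewrite /e hstarD linearD rmorphD.
have eZ c x : e (c *: x) = c * e x by rewrite /e hstarZ linearZ rmorphM /= conjCK.
have er : \tsum_(a1 ⊗ a2 <- Δ a) e a2 *: a1 = a.
  have := congr1 (@hstar C A) (counitr (hstar a)).
  rewrite hstarK Delta_star texp_texp_pure; last first.
    split=> [y c u v|y c u v]; first by rewrite scalerDr !scalerA mulrC.
    by rewrite linearP scalerDl scalerA.
  rewrite (texp_map (f := @hstar C A)); last exact: hstarD.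
  by under eq_texp => a1 a2 do rewrite hstarZ hstarK.
have <- : e a = eps a; last by rewrite /e conjCK.
rewrite -{1}(counitl a) -[in RHS]er (texp_map _ _ eD).
rewrite (texp_map (f := eps)); last exact: linearD.
by apply: eq_texp => a1 a2; rewrite linearZ eZ mulrC.
Qed.

Lemma skew_antipode_l a : \tsum_(a1 ⊗ a2 <- Δ a) T a2 * a1 = (eps a)%:A.
Proof.
have := congr1 (@hstar C A) (antipoder (hstar a)).
rewrite hstarZ hstar1 counit_star conjCK Delta_star.
rewrite texp_texp_pure; last exact: (antipode_bilinear A).
rewrite (texp_map (f := @hstar C A)); last exact: hstarD.
by under eq_texp => a1 a2 do rewrite hstarM hstarK.
Qed.

Lemma counit_skew_antipode a : eps (T a) = eps a.
Proof.
have := congr1 eps (skew_antipode_l a); rewrite linearZ /= counit1 mulr1 => <-.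
rewrite (texp_map (f := eps)); last exact: linearD.
rewrite -{1}(counitl a) (texp_map (f := fun a => eps (T a))); last first.
  by move=> u v; rewrite (linear_add skew_antipode_linear) linearD.
apply: eq_texp => a1 a2.
by rewrite counitM (linear_scale skew_antipode_linear) linearZ mulrC.
Qed.

End Counit.

Section Cancellation.
Variables (C : numClosedFieldType) (A : hopf_star_algebra C) (V : lmodType C).
Variables (G : A -> A -> V) (bG : bilinear_map G).
Local Notation S := (antipode A).
Local Notation Δ := (Delta A).
Local Notation T := (fun a : A => hstar (S (hstar a))).

Let GDl z : {morph G^~ z : x y / x + y}. Proof. exact: linear_add (bG.1 z). Qed.
Let GDr y : {morph G y : x y / x + y}. Proof. exact: linear_add (bG.2 y). Qed.

Lemma antipode_cancel a :
  \tsum_(a1 ⊗ a2 <- Δ a) \tsum_(b1 ⊗ b2 <- Δ a2) G (S a1 * b1) b2 = G 1 a.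
Proof.
rewrite (Delta_coassoc3 (F := fun x y z => G (S x * y) z)); last first.
  split=> [y z c u v|x]; first by rewrite linearP mulrDl -scalerAl bG.1.
  split=> [z|y] c u v; first by rewrite mulrDr -scalerAr bG.1.
  by rewrite bG.2.
rewrite -[in RHS](counitl a) (texp_map _ _ (GDr 1)); apply: eq_texp => a1 a2.
rewrite -(texp_map (f := G^~ a2)) // antipodel.
by rewrite (linear_scale (bG.1 _)) (linear_scale (bG.2 _)).
Qed.

Lemma skew_antipode_cancel a :
  \tsum_(a1 ⊗ a2 <- Δ a) \tsum_(b1 ⊗ b2 <- Δ a1) G b1 (T a2 * b2) = G a 1.
Proof.
rewrite -(Delta_coassoc3 (F := fun x y z => G x (T z * y))); last first.
  split=> [y z c u v|x]; first by rewrite bG.1.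
  split=> [z|y] c u v; first by rewrite mulrDr -scalerAr bG.2.
  by rewrite skew_antipode_linear mulrDl -scalerAl bG.2.
rewrite -[in RHS](counitr a) (texp_map _ _ (GDl 1)); apply: eq_texp => a1 a2.
rewrite -(texp_map (f := G a1)) // skew_antipode_l.
by rewrite (linear_scale (bG.1 _)) (linear_scale (bG.2 _)).
Qed.

End Cancellation.

(** * The differential and the involution of the calculus *)

Section Bimodule.
Variables (C : numClosedFieldType) (A : algType C) (M : bimodule A).

Lemma lact_sum (I : finType) (a : A) (F : I -> M) :
  a ·l (\sum_i F i) = \sum_i a ·l F i.
Proof.
have aD := linear_add (@lact_linr _ _ M a); exact: (big_morph _ aD (morph_add0 aD)).
Qed.

Lemma ract_sum (I : finType) (a : A) (F : I -> M) :
  (\sum_i F i) ·r a = \sum_i F i ·r a.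
Proof.
have aD := linear_add (@ract_linl _ _ M a); exact: (big_morph _ aD (morph_add0 aD)).
Qed.

Lemma lactBr (a : A) (x y : M) : a ·l (x - y) = a ·l x - a ·l y.
Proof. by rewrite -scaleN1r addrC lact_linr scaleN1r addrC. Qed.

Lemma lact_linear_bilinear (V W : lmodType C) (f : V -> A) (g : W -> M) :
  linear f -> linear g -> bilinear_map (fun y z => f y ·l g z).
Proof.
by move=> fl gl; split=> [z|y] c u v; [rewrite fl lact_linl | rewrite gl lact_linr].
Qed.

End Bimodule.

Section Differential.
Variables (C : numClosedFieldType) (A : hopf_star_algebra C) (Gam : star_calculus A).
Variables (n : nat) (theta : 'I_n -> Gam) (X : 'I_n -> {scalar A}).
Hypothesis theta_X : dual_bases theta X.
Local Notation S := (antipode A).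
Local Notation Δ := (Delta A).
Local Notation eps := (counit A).
Local Notation d := (calc_d Gam).
Local Notation T := (fun a : A => hstar (S (hstar a))).

(** The map [omega] of the calculus (see [maurer_cartanE]), written in the dual bases
    so that [calc_dE] and the matrix description of [beta] apply to it. *)
Definition maurer_cartan (a : A) : Gam := \sum_i X i a *: theta i.
Local Notation w := maurer_cartan.

Lemma maurer_cartan_linear : linear w.
Proof.
move=> c u v; rewrite /w scaler_sumr -big_split; apply: eq_bigr => i _.
by rewrite linearP scalerDl scalerA.
Qed.

Lemma d_maurer_cartan a : d a = \tsum_(a1 ⊗ a2 <- Δ a) a1 ·l w a2.
Proof.
rewrite (calc_dE theta_X) texp_sum; apply: eq_texp => a1 a2.
rewrite /w lact_sum; apply: eq_bigr => i _.
by rewrite (linear_scale (lact_linl _)) (linear_scale (lact_linr a1)).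
Qed.

Lemma lact_mul_mc_bilinear b c : bilinear_map (fun y z => (y * b) ·l w (z * c)).
Proof.
split=> [v|v] e x y; first by rewrite mulrDl -scalerAl lact_linl.
by rewrite mulrDl -scalerAl maurer_cartan_linear lact_linr.
Qed.

Lemma maurer_cartanE a : \tsum_(a1 ⊗ a2 <- Δ a) S a1 ·l d a2 = w a.
Proof.
have := antipode_cancel (lact_mul_mc_bilinear 1 1) a; rewrite mul1r mulr1 lact1 => <-.
apply: eq_texp => a1 a2; rewrite d_maurer_cartan (texp_map (f := lact (S a1))).
  by apply: eq_texp => b1 b2; rewrite !mulr1 lactM.
exact: linear_add (lact_linr _).
Qed.

Lemma calc_d1 : d 1 = 0.
Proof.
have := calc_leibniz Gam 1 1; rewrite mulr1 ract1 lact1 => /esym/eqP.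
by rewrite -subr_eq0 addrK => /eqP.
Qed.

Lemma lact_mc_bilinear : bilinear_map (fun y z => y ·l w z).
Proof. exact: (lact_linear_bilinear (f := id)) _ maurer_cartan_linear. Qed.

Lemma maurer_cartan1 : w 1 = 0.
Proof.
have := d_maurer_cartan 1.
by rewrite Delta1 calc_d1 (ctexp_pure _ _ lact_mc_bilinear) lact1.
Qed.

(** The right action on left-invariant forms: apply [S a1] to the Leibniz rule
    [d (a2 * b) = d a2 ·r b + a2 ·l d b]. *)
Lemma maurer_cartan_ract a b :
  w a ·r b = \tsum_(b1 ⊗ b2 <- Δ b) b1 ·l w (a * b2) - eps a *: d b.
Proof.
rewrite -maurer_cartanE (texp_map (f := @ract _ _ Gam ^~ b)); last first.
  exact: linear_add (ract_linl _).
transitivity (\tsum_(a1 ⊗ a2 <- Δ a) (S a1 ·l d (a2 * b) - (S a1 * a2) ·l d b)).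
  apply: eq_texp => a1 a2.
  by rewrite lractC lactM -lactBr calc_leibniz addrK.
rewrite texpB; congr (_ - _); last first.
  rewrite -(texp_map (f := @lact _ _ Gam ^~ (d b))); last exact: linear_add (lact_linl _).
  by rewrite antipodel (linear_scale (lact_linl _)) lact1.
have bil := lact_mc_bilinear.
transitivity (\tsum_(b1 ⊗ b2 <- Δ b) \tsum_(a1 ⊗ a2 <- Δ a)
    \tsum_(c1 ⊗ c2 <- Δ a2) (S a1 * c1 * b1) ·l w (c2 * b2)); last first.
  by apply: eq_texp => b1 b2; rewrite (antipode_cancel (lact_mul_mc_bilinear b1 b2)) mul1r.
rewrite texp_exchange; apply: eq_texp => a1 a2.
rewrite texp_exchange d_maurer_cartan DeltaM texp_texp //.
rewrite (texp_map (f := lact (S a1))); last exact: linear_add (lact_linr _).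
apply: eq_texp => c1 c2; rewrite texp_texp_pure //.
rewrite (texp_map (f := lact (S a1))); last exact: linear_add (lact_linr _).
by apply: eq_texp => b1 b2; rewrite -lactM mulrA.
Qed.

(** Moving [w (T q2)] past [q1] with [maurer_cartan_ract] leaves [q1 ·l w (T q3 * q2)],
    which reduces to [q ·l w 1 = 0], and the counit term, which is [- d q]. *)
Lemma d_skew_antipode q : \tsum_(q1 ⊗ q2 <- Δ q) w (T q2) ·r q1 = - d q.
Proof.
under eq_texp => q1 q2 do rewrite maurer_cartan_ract counit_skew_antipode -linearZ.
rewrite texpB -(texp_map (f := d)); last exact: linearD.
rewrite counitr (skew_antipode_cancel lact_mc_bilinear) maurer_cartan1.
by rewrite (morph_add0 (linear_add (lact_linr _))) sub0r.
Qed.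

Section Involution.
Variables (h : {scalar A}) (h_haar : haar_functional h).
Variables (rho : A -> A) (rho_linear : linear rho).
Hypotheses (rho1 : rho 1 = 1) (h_rho : forall a b, h (a * b) = h (b * rho a)).
Variables (B : 'M[C]_n) (beta : Gam -> Gam).
Hypothesis beta_inv : calc_involution theta X rho B beta.

(** The matrix [B] acts contragrediently on the [theta i] and on the [X i], so it
    disappears from the sum over the dual bases. *)
Lemma beta_theta_X a :
  \sum_i (X i a)^* *: beta (theta i) = w (S (S (hstar (S a)))).
Proof.
rewrite /w; under eq_bigr => i _ do rewrite (beta_theta beta_inv) scaler_sumr.
rewrite exchange_big; apply: eq_bigr => j _.
have E : (X j (S (S (hstar (S a)))))^* = \sum_i B j i * X i a := beta_X beta_inv j a.
rewrite -[X j _]conjCK E rmorph_sum scaler_suml.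
by apply: eq_bigr => i _; rewrite scalerA -rmorphM mulrC.
Qed.

(** Applying [beta] to [d a = a1 ·l w a2] reverses the factors, and
    [modular_coproduct] identifies the result with the left side of
    [d_skew_antipode] at [beta_alg rho a]. *)
Lemma beta_d a : beta (d a) = - d (beta_alg rho a).
Proof.
have betaD := antilinear_add (beta_antilinear beta_inv).
have beta0 := morph_add0 betaD.
rewrite (calc_dE theta_X) (big_morph _ betaD beta0).
under eq_bigr => i _ do rewrite (texp_map _ _ betaD).
rewrite texp_sum -d_skew_antipode /beta_alg Delta_star.
pose G x y := w (S (S (hstar (S y)))) ·r hstar x.
transitivity (\tsum_(a1 ⊗ a2 <- Δ a) G (rho a1) a2).
  apply: eq_texp => a1 a2; rewrite /G -beta_theta_X ract_sum; apply: eq_bigr => i _.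
  have := beta_bim beta_inv (X i a2 *: a1) (theta i) 1.
  rewrite ract1 /beta_alg rho1 hstar1 lact1 => ->.
  rewrite (linear_scale rho_linear) hstarZ.
  by rewrite (linear_scale (ract_linl _)) (linear_scale (ract_linr _)).
have bG : bi_antilinear G.
  split=> [y|x] c u v; first by rewrite /G hstarD hstarZ ract_linr.
  by rewrite /G linearP hstarD hstarZ !linearP maurer_cartan_linear ract_linl.
rewrite -(texp_texp_anti _ _ _ bG) -(modular_coproduct h_haar rho_linear h_rho).
rewrite texp_texp_anti // texp_texp_pure; last first.
  split=> [y|x] c u v; first by rewrite ract_linr.
  by rewrite skew_antipode_linear maurer_cartan_linear ract_linl.
apply: eq_texp => p1 p2.
by rewrite /G (antipode_star h_haar) (antipode_star h_haar) hstarK.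
Qed.

End Involution.
End Differential.

(** * Invariant elements of a left-covariant module *)

Section HopfModule.
Variables (C : numClosedFieldType) (A : hopf_star_algebra C).
Variables (h : {scalar A}) (h_haar : haar_functional h).
Variables (M : bimodule A) (delta : {linear M -> ctens A M}).
Local Notation S := (antipode A).
Local Notation Δ := (Delta A).

Hypothesis delta_coassoc : forall x, \tsum_(a ⊗ y <- delta x) a ⊗ delta y =
  \tsum_(a ⊗ y <- delta x) \tsum_(a1 ⊗ a2 <- Δ a) a1 ⊗ a2 ⊗ y.
Hypothesis delta_counit : forall x, \tsum_(a ⊗ y <- delta x) counit A a *: y = x.
Hypothesis delta_lact : forall a x, delta (a ·l x) =
  \tsum_(a1 ⊗ a2 <- Δ a) \tsum_(b ⊗ y <- delta x) (a1 * b) ⊗ (a2 ·l y).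

Definition haar_proj (x : M) : M := \tsum_(a ⊗ y <- delta x) h a *: y.

Lemma haar_proj_bilinear : bilinear_map (fun (a : A) (y : M) => h a *: y).
Proof. exact: (scale_bilinear (f := id)) (linearP h) _. Qed.

Lemma haar_proj_invariant x : left_invariant delta (haar_proj x).
Proof.
have [_ _ hr] := h_haar.
have bil : bilinear_map (fun y z : A => h y *: z).
  exact: (scale_bilinear (f := id)) (linearP h) _.
rewrite /left_invariant /haar_proj (texp_map (f := delta)); last exact: linearD.
transitivity (\tsum_(a ⊗ y <- delta x) \tsum_(b ⊗ z <- delta y) h a *: (b ⊗ z)).
  apply: eq_texp => a y; rewrite linearZ /= [in LHS](ctensE (delta y)).
  by rewrite (texp_map (f := *:%R (h a))) //; apply: scalerDr.
rewrite comodule_coassoc //; last first.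
  split=> [b z c u v|a]; first by rewrite linearP scalerDl scalerA.
  split=> [z|b] c u v; first by rewrite ctpure_linl scalerDr !scalerA mulrC.
  by rewrite ctpure_linr scalerDr !scalerA mulrC.
rewrite (texp_map (f := fun u : M => 1 ⊗ u : ctens A M)); last first.
  exact: linear_add (ctpure_linr _).
apply: eq_texp => a y.
rewrite (linear_scale (ctpure_linr (1 : A))) -(linear_scale (ctpure_linl y)) -hr.
rewrite [RHS](texp_map (f := fun u : A => u ⊗ y : ctens A M)); last first.
  exact: linear_add (ctpure_linl _).
by apply: eq_texp => a1 a2; rewrite (linear_scale (ctpure_linl y)).
Qed.

Definition left_inv_part (x : M) : M := \tsum_(a ⊗ y <- delta x) S a ·l y.
Local Notation Q := left_inv_part.

Lemma left_inv_part_linear : linear Q.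
Proof.
have bil := lact_linear_bilinear (linearP S) (f := S) (fun c (u v : M) => erefl (c *: u + v)).
by move=> c u v; rewrite /Q linearP ctexp_linear.
Qed.

(** The analogue of [haar_shift] for [M].  It compares the average over [h], whose
    invariance is immediate, with [left_inv_part], which decomposes [x]. *)
Lemma haar_proj_lact b x : haar_proj (b ·l x) = \tsum_(a ⊗ y <- delta x) h (b * a) *: Q y.
Proof.
rewrite /haar_proj delta_lact texp_texp; last exact: haar_proj_bilinear.
under eq_texp => b1 b2 do rewrite (texp_texp_pure _ _ _ haar_proj_bilinear).
rewrite texp_exchange.
transitivity (\tsum_(a ⊗ y <- delta x) \tsum_(a1 ⊗ a2 <- Δ a) h (b * a1) *: (S a2 ·l y)).
  apply: eq_texp => a y.
  have lD := linear_add (lact_linl y).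
  have lZ := linear_scale (lact_linl y).
  under eq_texp => b1 b2 do rewrite -lZ.
  under [in RHS]eq_texp => b1 b2 do rewrite -lZ.
  by rewrite -!(texp_map (f := fun u => u ·l y)) // (haar_shift h_haar).
rewrite -(comodule_coassoc (F := fun a c z => h (b * a) *: (S c ·l z))) //; last first.
  split=> [c z e u v|a]; first by rewrite mulrDr -scalerAr linearP scalerDl scalerA.
  split=> [z|c] e u v; first by rewrite linearP lact_linl scalerDr !scalerA mulrC.
  by rewrite lact_linr scalerDr !scalerA mulrC.
apply: eq_texp => a y.
by rewrite [RHS](texp_map (f := *:%R (h (b * a)))) //; apply: scalerDr.
Qed.

(** The averages [haar_proj (b ·l x)] are invariant for all [b]; by [haar_proj_lact]
    and non-degeneracy of [h], [left_inv_part] is invariant on every component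
    of [delta x]. *)
Lemma left_inv_part_invariant x : left_invariant delta (Q x).
Proof.
have dQ : linear (fun y => delta (Q y)) by move=> c u v; rewrite left_inv_part_linear linearP.
have oneQ : linear (fun y => 1 ⊗ Q y : ctens A M).
  by move=> c u v; rewrite left_inv_part_linear ctpure_linr.
have E : \tsum_(a ⊗ y <- delta x) a ⊗ delta (Q y) =
         \tsum_(a ⊗ y <- delta x) a ⊗ (1 ⊗ Q y) :> ctens A (ctens A M).
  apply: (tens_separated (f := fun b u => h (b * u))) => [b|z|b].
  - exact: haar_mulr.
  - exact: (haar_nondegenerate_l h_haar).
  have bil := scale_bilinear (haar_mulr h b) (fun c (u v : ctens A M) => erefl (c *: u + v)).
  rewrite !texp_texp_pure //.
  have := haar_proj_invariant (b ·l x); rewrite /left_invariant haar_proj_lact.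
  rewrite (texp_map (f := delta)); last exact: linearD.
  rewrite (texp_map (f := fun u : M => 1 ⊗ u : ctens A M)); last first.
    exact: linear_add (ctpure_linr _).
  under eq_texp => a y do rewrite linearZ.
  move=> ->; apply: eq_texp => a y.
  by rewrite (linear_scale (ctpure_linr (1 : A))).
have bil := scale_bilinear (linearP (counit A)) (fun c (u v : ctens A M) => erefl (c *: u + v)).
have := congr1 (fun t : ctens A (ctens A M) => \tsum_(a ⊗ s <- t) counit A a *: s) E.
rewrite !texp_texp_pure //.
under eq_texp => a y do rewrite -(linear_scale dQ).
under [in X in _ = X -> _]eq_texp => a y do rewrite -(linear_scale oneQ).
rewrite -(texp_map (f := fun y => delta (Q y))); last exact: linear_add dQ.
rewrite -(texp_map (f := fun y => 1 ⊗ Q y : ctens A M)); last exact: linear_add oneQ.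
by rewrite delta_counit.
Qed.

(** The generation part of the structure theorem for Hopf modules; the sum
    collapses because [a1 * S a2] does. *)
Lemma left_inv_decomposition x : x = \tsum_(a ⊗ y <- delta x) a ·l Q y.
Proof.
transitivity (\tsum_(a ⊗ y <- delta x) \tsum_(b ⊗ z <- delta y) (a * S b) ·l z); last first.
  apply: eq_texp => a y; rewrite [RHS](texp_map (f := lact a)).
    by apply: eq_texp => b z; rewrite lactM.
  exact: linear_add (lact_linr a).
rewrite comodule_coassoc //; last first.
  split=> [b z c u v|a]; first by rewrite mulrDl -scalerAl lact_linl.
  split=> [z|b] c u v; first by rewrite linearP mulrDr -scalerAr lact_linl.
  by rewrite lact_linr.
rewrite -[LHS]delta_counit; apply: eq_texp => a y.
rewrite -[RHS](texp_map (f := fun u => u ·l y)); last exact: linear_add (lact_linl y).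
by rewrite antipoder (linear_scale (lact_linl y)) lact1.
Qed.

End HopfModule.

(** * Generators of the Clifford algebra and spinor modules *)

Section Generators.
Variables (C : numClosedFieldType) (A : algType C) (M : bimodule A).

Lemma tvec_ract (m : M) (a : A) : tvec (m ·r a) = tvec m * tscal M a.
Proof.
rewrite /tvec /tscal [RHS]talg_mul_tin [tpow_mul _ _]tpow_mulS /= mul1r.
by rewrite btpure_bal /= mulr1.
Qed.

Lemma tvec_lact (m : M) (a : A) : tvec (a ·l m) = tscal M a * tvec m.
Proof. by rewrite /tvec /tscal [RHS]talg_mul_tin -lact_btpure. Qed.

Lemma tvec_linear : linear (@tvec C A M).
Proof. by move=> c x y; rewrite /tvec btpure_linl tin_linear. Qed.

Lemma tin_btpure k (m : M) (x : tpow M k) :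
  tin (k := k.+1) (m ⊙ x) = tvec m * tin x.
Proof. by rewrite /tvec [RHS]talg_mul_tin [tpow_mul _ _]tpow_mulS /= lact1. Qed.

Variables (sigma : btens M M -> btens M M) (g : btens M M -> A).
Local Notation scal := (cl_scal sigma g).
Local Notation vec := (cl_vec sigma g).

Lemma cl_vec_ract m a : vec (m ·r a) = vec m * scal a.
Proof. by rewrite /cl_vec tvec_ract rmorphM. Qed.
Lemma cl_vec_lact m a : vec (a ·l m) = scal a * vec m.
Proof. by rewrite /cl_vec tvec_lact rmorphM. Qed.
Lemma cl_vec_linear : linear vec.
Proof. by move=> c x y; rewrite /cl_vec tvec_linear linearP. Qed.

Lemma cl_generated (P : Cl sigma g -> Prop) :
  (forall u v, P u -> P v -> P (u + v)) -> (forall u v, P u -> P v -> P (u * v)) ->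
  (forall a, P (scal a)) -> (forall m, P (vec m)) -> forall u, P u.
Proof.
move=> PD PM Pscal Pvec.
have P0 : P 0.
  by have := Pscal 0; rewrite (morph_add0 (linear_add (@cl_scal_linear _ _ _ sigma g))).
have PZ c u : P u -> P (c *: u).
  move=> Pu; rewrite -[u]mul1r -cl_scal1 cl_scaleAl.
  by rewrite -(linear_scale (@cl_scal_linear _ _ _ sigma g)); apply: PM.
have Ptin k (x : tpow M k) : P (cl_pi sigma g (tin x)).
  elim: k x => [|k IH] x; first exact: Pscal.
  rewrite [x](tdecompE (x : btens M (tpow M k))).
  have tD := linear_add (@tin_linear _ _ M k.+1).
  rewrite (big_morph _ tD (morph_add0 tD)) linear_sum.
  apply: (big_ind P) => // p _.
  rewrite -[tpure _ _ _ _]/(p.1 ⊙ p.2) tin_btpure rmorphM.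
  by apply: PM; [apply: Pvec | apply: IH].
elim/cl_ind=> t.
have -> : t = pmod_lift (pmod_gen (@dsum_adm C A M)) t.
  apply: (pmod_ext_gen (f := id)) => //.
    by apply: pmod_lift_linear => k; apply: tin_linear.
  by move=> x; rewrite pmod_lift_gen // => k; apply: tin_linear.
rewrite /pmod_lift /pmod_eval linear_sum; apply: (big_ind P) => // -[c [k x]] _.
by rewrite linearZ; apply: PZ; apply: Ptin.
Qed.

Variable I : cl_left_ideal sigma g.
Local Notation SB := (li_bimodule I).

Lemma li_act_mul (u v : Cl sigma g) (s : li_type I) :
  li_act (u * v) s = li_act u (li_act v s).
Proof. by apply: li_val_inj; rewrite /= mulrA. Qed.

Lemma li_act_linl (s : SB) : linear (fun u : Cl sigma g => li_act u s : SB).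
Proof.
move=> c u v; apply: li_val_inj; apply: etrans (esym (li_val_linear _ _ _)).
by rewrite /= mulrDl -cl_scaleAl.
Qed.

Lemma li_act_linr (u : Cl sigma g) : linear (fun s : SB => li_act u s : SB).
Proof.
move=> c s t; apply: li_val_inj; apply: etrans (esym (li_val_linear _ _ _)).
rewrite [RHS]/= cl_scaleAr -mulrDr; congr (_ * _); exact: li_val_linear.
Qed.

Lemma clifford_balanced : balanced (fun (x : M) (a : A) => x ·r a)
  (fun a (s : SB) => a ·l s) (fun p => li_act (vec p.1) p.2 : SB).
Proof.
split=> [s|x|x a s] /=.
- by move=> c x y; rewrite cl_vec_linear li_act_linl.
- exact: li_act_linr.
- by rewrite cl_vec_ract li_act_mul.
Qed.

End Generators.

(** * Adjoints and the Dirac operator *)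

Section Spinors.
Variables (C : numClosedFieldType) (A : hopf_star_algebra C).
Variables (h : {scalar A}) (h_haar : haar_functional h).
Variables (rho : A -> A) (rho_linear : linear rho) (rho1 : rho 1 = 1).
Hypothesis h_rho : forall a b : A, h (a * b) = h (b * rho a).
Variables (Gam : star_calculus A) (n : nat).
Variables (theta : 'I_n -> Gam) (X : 'I_n -> {scalar A}).
Hypothesis theta_X : dual_bases theta X.
Variables (B : 'M[C]_n) (beta : Gam -> Gam).
Hypothesis beta_inv : calc_involution theta X rho B beta.
Variables (sigma : btens Gam Gam -> btens Gam Gam) (g : btens Gam Gam -> A).
Variable delta : {linear cl_bimodule sigma g -> ctens A (cl_bimodule sigma g)}.
Hypothesis delta_coaction : cl_coaction delta.
Variable betaCl : Cl sigma g -> Cl sigma g.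
Hypothesis betaCl_inv : cl_involution rho beta betaCl.
Variable I : cl_left_ideal sigma g.
Local Notation SB := (li_bimodule I).
Variable deltaS : {linear SB -> ctens A SB}.
Hypothesis S_covariant : li_coaction delta deltaS.
Variable form0 : SB -> SB -> A.
Hypothesis form0_metric : spinor_metric h deltaS form0.
Local Notation form phi psi := (h (form0 phi psi)).
Local Notation scal := (cl_scal sigma g).
Local Notation vec := (cl_vec sigma g).
Local Notation d := (calc_d Gam).

Lemma form0_lact a phi psi : form0 (a ·l phi) psi = a * form0 phi psi.
Proof. by rewrite -[psi in LHS]lact1 (form0M form0_metric) hstar1 mulr1. Qed.
Lemma form0_ractr a phi psi : form0 phi (a ·l psi) = form0 phi psi * hstar a.
Proof. by rewrite -[phi in LHS]lact1 (form0M form0_metric) mul1r. Qed.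

Lemma scale_lact (c : C) (phi : SB) : c *: phi = (c%:A) ·l phi.
Proof. by rewrite (linear_scale (lact_linl phi)) lact1. Qed.

Lemma form0_linl psi : linear (form0^~ psi).
Proof.
move=> c x y; rewrite (form0Dl form0_metric) scale_lact form0_lact.
by rewrite mulr_algl.
Qed.
Lemma form0_antilinr phi : antilinear (form0 phi).
Proof.
move=> c x y; rewrite (form0Dr form0_metric) scale_lact form0_ractr.
by rewrite hstarZ hstar1 mulr_algr.
Qed.

Lemma formDl phi phi' psi : form (phi + phi') psi = form phi psi + form phi' psi.
Proof. by rewrite (form0Dl form0_metric) linearD. Qed.
Lemma formDr phi psi psi' : form phi (psi + psi') = form phi psi + form phi psi'.
Proof. by rewrite (form0Dr form0_metric) linearD. Qed.
Lemma formNl phi psi : form (- phi) psi = - form phi psi.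
Proof.
apply/eqP; rewrite -addr_eq0 -formDl addNr.
by rewrite (morph_add0 (linear_add (form0_linl psi))) linear0.
Qed.
Lemma formNr phi psi : form phi (- psi) = - form phi psi.
Proof.
apply/eqP; rewrite -addr_eq0 -formDr addNr.
by rewrite (morph_add0 (antilinear_add (form0_antilinr phi))) linear0.
Qed.

Definition adjoint_pair (u v : Cl sigma g) : Prop :=
  forall phi psi : SB, form (li_act u phi) psi = form phi (li_act v psi).

Lemma form_modular a phi psi : form (a ·l phi) psi = form phi (beta_alg rho a ·l psi).
Proof. by rewrite form0_lact form0_ractr /beta_alg hstarK h_rho. Qed.

(** The elements that satisfy the adjunction are closed under sums and products
    and contain [A] by [form_modular]; the calculus is spanned by the [a ·l d b]. *)
Lemma adjoint_generated :
  (forall a, adjoint_pair (vec (d a)) (betaCl (vec (d a)))) ->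
  forall u, adjoint_pair u (betaCl u).
Proof.
move=> adj_d.
have betaD := antilinear_add (betaCl_antilinear betaCl_inv).
have adjD u v : adjoint_pair u (betaCl u) -> adjoint_pair v (betaCl v) ->
    adjoint_pair (u + v) (betaCl (u + v)).
  move=> Hu Hv phi psi; rewrite betaD (linear_add (li_act_linl phi)) formDl.
  by rewrite (linear_add (li_act_linl psi)) formDr Hu Hv.
have adjM u v : adjoint_pair u (betaCl u) -> adjoint_pair v (betaCl v) ->
    adjoint_pair (u * v) (betaCl (u * v)).
  by move=> Hu Hv phi psi; rewrite (betaClM betaCl_inv) !li_act_mul Hu Hv.
have adj_scal a : adjoint_pair (scal a) (betaCl (scal a)).
  by move=> phi psi; rewrite (betaCl_scal betaCl_inv); apply: form_modular.
apply: cl_generated => // x.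
have [s ->] := calc_span x.
elim: s => [|p s IH].
  rewrite big_nil (morph_add0 (linear_add (@cl_vec_linear _ _ _ sigma g))).
  rewrite -(morph_add0 (linear_add (@cl_scal_linear _ _ _ sigma g))).
  exact: adj_scal.
rewrite big_cons (linear_add (@cl_vec_linear _ _ _ sigma g)); apply: adjD => //.
by rewrite cl_vec_lact; apply: adjM.
Qed.

Lemma betaCl_d a : betaCl (vec (d a)) = - vec (d (beta_alg rho a)).
Proof.
rewrite (betaCl_vec betaCl_inv) (beta_d theta_X h_haar rho_linear rho1 h_rho beta_inv).
by rewrite -scaleN1r (linear_scale (@cl_vec_linear _ _ _ sigma g)) scaleN1r.
Qed.

Lemma deltaS_lact a phi : deltaS (a ·l phi) =
  \tsum_(a1 ⊗ a2 <- Delta A a) \tsum_(b ⊗ s <- deltaS phi) (a1 * b) ⊗ (a2 ·l s).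
Proof.
rewrite (li_coactM S_covariant (scal a) phi) (cl_coact_scal delta_coaction).
rewrite texp_texp_pure //; split=> [u|b] c x y.
  apply: texp_lin => b s.
  by rewrite mulrDl -scalerAl ctpure_linl.
apply: texp_lin => e s.
by rewrite li_act_linl ctpure_linr.
Qed.

(** For invariant [phi] the coproduct of [form0 phi psi] only sees the coaction of
    [psi], and invariance of [h] averages over it. *)
Lemma form_haar_proj phi psi : left_invariant deltaS phi ->
  form phi psi = form phi (haar_proj h deltaS psi).
Proof.
move=> phi_inv; have [h1 _ hr] := h_haar.
have bil : bilinear_map (fun y z : A => h y *: z).
  exact: (scale_bilinear (f := id)) (linearP h) _.
have := hr (form0 phi psi).
rewrite (form0_cov form0_metric) phi_inv ctexp_pure; last first.
  split=> [y|x] c u v; apply: texp_lin => b s.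
    by rewrite mulrDl -scalerAl ctpure_linl.
  by rewrite form0_linl ctpure_linr.
rewrite texp_texp_pure //.
have -> : \tsum_(b ⊗ s <- deltaS psi) h (1 * hstar b) *: form0 phi s =
          form0 phi (haar_proj h deltaS psi).
  rewrite /haar_proj (texp_map (f := form0 phi)); last first.
    exact: antilinear_add (form0_antilinr phi).
  apply: eq_texp => b s.
  by rewrite mul1r (haar_star h_haar) (antilinear_scale (form0_antilinr phi)).
by move=> ->; rewrite linearZ /= h1 mulr1.
Qed.

Variable nabla : SB -> btens Gam SB.
Hypothesis nabla_connection : left_connection nabla.
Hypothesis nabla_cov : forall phi, coact2 (coact Gam) deltaS (nabla phi) =
    \tsum_(a ⊗ phi0 <- deltaS phi) a ⊗ nabla phi0.
Local Notation D := (dirac nabla).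

Definition clifford_mul (t : btens Gam SB) : SB :=
  \tsum_(x ⊗ s <- t) (li_act (vec x) s : SB).

Lemma clifford_mul_linear : linear clifford_mul.
Proof. exact: texp_linear (clifford_balanced I). Qed.

Lemma dirac_linear : linear D.
Proof.
by move=> c x y; rewrite /dirac (proj1 nabla_connection) [LHS]clifford_mul_linear.
Qed.

Lemma clifford_mul_pure x s : clifford_mul (x ⊙ s) = li_act (vec x) s.
Proof. exact: texp_pure (clifford_balanced I). Qed.

Lemma clifford_mul_lact a t : clifford_mul (a ·l t) = a ·l clifford_mul t.
Proof.
apply: (btens_ext (f := fun t : btens Gam SB => clifford_mul (a ·l t))
  (g := fun t : btens Gam SB => a ·l clifford_mul t)) t.
- by move=> c t u; rewrite lact_linr clifford_mul_linear.
- by move=> c t u; rewrite clifford_mul_linear lact_linr.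
move=> x s; rewrite -[btens_pure x s]/(x ⊙ s) lact_btpure !clifford_mul_pure.
by rewrite cl_vec_lact li_act_mul.
Qed.

Lemma dirac_leibniz a phi : D (a ·l phi) = li_act (vec (d a)) phi + a ·l D phi.
Proof.
rewrite /dirac (proj2 nabla_connection) -/(clifford_mul _).
by rewrite (linear_add clifford_mul_linear) clifford_mul_pure clifford_mul_lact.
Qed.

(** Clifford multiplication intertwines the coactions, and [nabla] does by [nabla_cov]. *)
Lemma dirac_cov phi : deltaS (D phi) = \tsum_(a ⊗ psi <- deltaS phi) a ⊗ D psi.
Proof.
have bil : bilinear_map (fun (a : A) (t : btens Gam SB) => a ⊗ clifford_mul t : ctens A SB).
  split=> [t|a] c u v; first exact: ctpure_linl.
  by rewrite clifford_mul_linear ctpure_linr.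
have := congr1 (fun t : ctens A (btens Gam SB) => \tsum_(a ⊗ t0 <- t) a ⊗ clifford_mul t0)
  (nabla_cov phi).
rewrite texp_texp_pure // => <-; rewrite /coact2 texp_texp //.
rewrite /dirac (texp_map (f := deltaS)); last exact: linearD.
apply: eq_texp => x s.
rewrite (li_coactM S_covariant) (cl_coact_vec delta_coaction).
rewrite texp_texp_pure; last first.
  split=> [u|b] c y z; apply: texp_lin => e w; first by rewrite mulrDl -scalerAl ctpure_linl.
  by rewrite li_act_linl ctpure_linr.
rewrite [RHS]texp_texp //; apply: eq_texp => a x0; rewrite texp_texp_pure //.
by apply: eq_texp => b s0; rewrite clifford_mul_pure.
Qed.

Lemma dirac_haar_proj psi : haar_proj h deltaS (D psi) = D (haar_proj h deltaS psi).
Proof.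
rewrite /haar_proj dirac_cov texp_texp_pure; last exact: haar_proj_bilinear.
rewrite (texp_map (f := D)); last exact: linear_add dirac_linear.
by apply: eq_texp => a s; rewrite (linear_scale dirac_linear).
Qed.

Lemma dirac_invariant phi : left_invariant deltaS phi -> left_invariant deltaS (D phi).
Proof.
rewrite /left_invariant dirac_cov => ->; rewrite ctexp_pure //.
by split=> [s|a] c x y; [exact: ctpure_linl | rewrite dirac_linear ctpure_linr].
Qed.

(** By [dirac_leibniz] and [betaCl_d], the symmetry defects of [D] at
    [(a ·l phi, psi)] and at [(phi, beta_alg rho a ·l psi)] differ by the adjunction
    defect of [d a].  So symmetry gives the adjunction, and the adjunction
    reduces symmetry to invariant [phi], where [haar_proj] makes [psi] invariant
    as well. *)
Lemma dirac_symmetric_iff :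
  (forall phi psi, form (D phi) psi = form phi (D psi)) <->
  (forall phi psi, left_invariant deltaS phi -> left_invariant deltaS psi ->
     form (D phi) psi = form phi (D psi)) /\
  (forall u, adjoint_pair u (betaCl u)).
Proof.
split=> [D_sym | [D_sym_inv adj]].
  split=> [phi psi _ _ //|]; apply: adjoint_generated => a phi psi.
  have -> : li_act (vec (d a)) phi = D (a ·l phi) - a ·l D phi.
    by rewrite dirac_leibniz addrK.
  rewrite formDl formNl D_sym !form_modular D_sym dirac_leibniz formDr.
  rewrite opprD addrCA subrr addr0 betaCl_d.
  by rewrite -scaleN1r (linear_scale (li_act_linl psi)) scaleN1r formNr.
have sym_inv phi psi : left_invariant deltaS phi -> form (D phi) psi = form phi (D psi).
  move=> phi_inv.
  rewrite form_haar_proj; last exact: dirac_invariant.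
  rewrite [RHS]form_haar_proj // dirac_haar_proj D_sym_inv //.
  exact: (haar_proj_invariant h_haar (li_coact_coassoc S_covariant)).
have sym_lact a phi psi : left_invariant deltaS phi ->
    form (D (a ·l phi)) psi = form (a ·l phi) (D psi).
  move=> phi_inv; rewrite dirac_leibniz formDl adj !form_modular sym_inv //.
  rewrite dirac_leibniz formDr betaCl_d.
  by rewrite -scaleN1r (linear_scale (li_act_linl psi)) scaleN1r formNr addKr.
move=> phi psi.
rewrite (left_inv_decomposition (li_coact_coassoc S_covariant) (li_coact_counit S_covariant) phi).
rewrite (texp_map (f := D)); last exact: linear_add dirac_linear.
have fD : {morph (fun x => form x psi) : x y / x + y} by move=> x y; exact: formDl.
have fD' : {morph (fun x => form x (D psi)) : x y / x + y} by move=> x y; exact: formDl.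
rewrite (texp_map _ _ fD) (texp_map _ _ fD'); apply: eq_texp => a s.
apply: sym_lact; apply: (left_inv_part_invariant h_haar).
- exact: (li_coact_coassoc S_covariant).
- exact: (li_coact_counit S_covariant).
- exact: deltaS_lact.
Qed.

End Spinors.

(** * The theorem *)

Local Open Scope complex_scope.

Theorem proposition5p3 (R : realType) (A : hopf_star_algebra R[i])
    (A_cosemisimple : cosemisimple A)
    (h : {scalar A}) (h_haar : haar_functional h)
    (rho : {lrmorphism A -> A}) (rho_bij : bijective rho)
    (h_rho : forall a b : A, h (a * b) = h (b * rho a))
    (beta_algK : involutive (beta_alg rho))
    (Gam : star_calculus A) (n : nat)
    (theta : 'I_n -> Gam) (X : 'I_n -> {scalar A}) (theta_X : dual_bases theta X)
    (F : 'M[R[i]]_n) (S2 : Gam -> Gam) (S2_inv : S2_invariant theta X F S2)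
    (B : 'M[R[i]]_n) (beta : Gam -> Gam)
    (beta_inv : calc_involution theta X rho B beta)
    (sigma sigmaV : btens Gam Gam -> btens Gam Gam)
    (sigma_braiding : braiding S2 sigma sigmaV)
    (g : btens Gam Gam -> A) (g_metric : sigma_metric S2 sigma sigmaV g)
    (delta : {linear cl_bimodule sigma g -> ctens A (cl_bimodule sigma g)})
    (delta_coaction : cl_coaction delta)
    (betaCl : Cl sigma g -> Cl sigma g)
    (betaCl_inv : cl_involution rho beta betaCl)
    (S : cl_left_ideal sigma g)
    (deltaS : {linear li_bimodule S -> ctens A (li_bimodule S)})
    (S_covariant : li_coaction delta deltaS)
    (form0 : li_bimodule S -> li_bimodule S -> A)
    (form0_metric : spinor_metric h deltaS form0)
    (nabla : cl_bimodule sigma g -> btens Gam (cl_bimodule sigma g))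
    (st : btens (cl_bimodule sigma g) Gam -> btens Gam (cl_bimodule sigma g))
    (nabla_linear : linear_left_connection nabla st)
    (nablaS : li_bimodule S -> btens Gam (li_bimodule S))
    (stS : btens (li_bimodule S) Gam -> btens Gam (li_bimodule S))
    (nablaS_compat : spinor_connection deltaS nabla st nablaS stS) :
  let form phi psi := h (form0 phi psi) in
  let D := dirac nablaS in
  (forall phi psi : li_bimodule S, form (D phi) psi = form phi (D psi)) <->
  (forall phi psi : li_bimodule S,
      left_invariant deltaS phi -> left_invariant deltaS psi ->
      form (D phi) psi = form phi (D psi)) /\
  (forall (u : Cl sigma g) (phi psi : li_bimodule S),
      form (li_act u phi) psi = form phi (li_act (betaCl u) psi)).
Proof.
have rho_linear : linear rho by exact: linearP.
have [nablaS_left _ _ _] := sc_bimodule nablaS_compat.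
exact: (dirac_symmetric_iff h_haar rho_linear (rmorph1 rho) h_rho theta_X beta_inv
  delta_coaction betaCl_inv S_covariant form0_metric nablaS_left (sc_cov nablaS_compat)).
Qed.
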